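(* Let $G=\ast_{j\in J} A_j$ be a free product of nontrivial groups and let $n$ be a positive integer. Then $$k(G,n) = \left\lfloor \frac{n}{2}\right\rfloor - \left\lfloor \frac{n}{N(G)}\right\rfloor + 1.$$
   Context: For a group $G$ with a fixed free-product decomposition $G=\ast_{j\in J} A_j$, let $\hat G$ be the set of elements of $G$ not conjugate to elements of any free factor $A_j$. The commutator length $\mathrm{cl}(h)$ of $h\in[G,G]$ is the minimal $k$ such that $h$ is a product of $k$ commutators, where $[x,y]=x^{-1}y^{-1}xy$. Define $k(G,n)$ as the minimal number $k$ such that some element $g^n\in\hat G$ (with $g\in G$) can be written as a product of $k$ commutators. $N(G)$ denotes the minimal order of a nonidentity element of $G$. If $N(G)=\infty$, the term $\lfloor n/N(G)\rfloor$ is interpreted as $0$. $\lfloor x\rfloor$ denotes the integer part of $x$. *)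

(* Defs.v *)
From Stdlib Require Import List Arith.
Import ListNotations.

Record Group := {
  carrier :> Type;
  gmul : carrier -> carrier -> carrier;
  gone : carrier;
  ginv : carrier -> carrier;
  gmulA : forall x y z, gmul x (gmul y z) = gmul (gmul x y) z;
  gmul1l : forall x, gmul gone x = x;
  gmul1r : forall x, gmul x gone = x;
  gmulVl : forall x, gmul (ginv x) x = gone;
  gmulVr : forall x, gmul x (ginv x) = gone
}.

Section GroupDefs.
Variable G : Group.

Fixpoint gpow (x : G) (n : nat) : G :=
  match n with 0 => gone G | S m => gmul G x (gpow x m) end.

Definition comm (x y : G) : G :=
  gmul G (ginv G x) (gmul G (ginv G y) (gmul G x y)).

Fixpoint prod_comms (k : nat) (h : G) : Prop :=
  match k with
  | 0 => h = gone G
  | S m => exists x y h', prod_comms m h' /\ h = gmul G (comm x y) h'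
  end.

Definition is_subgroup (A : G -> Prop) : Prop :=
  A (gone G) /\ (forall x y, A x -> A y -> A (gmul G x y))
  /\ (forall x, A x -> A (ginv G x)).

Fixpoint word_prod {J : Type} (w : list (J * G)) : G :=
  match w with [] => gone G | (_, a) :: w' => gmul G a (word_prod w') end.

Fixpoint alternating {J : Type} (w : list (J * G)) : Prop :=
  match w with
  | [] => True
  | (j, _) :: w' =>
      match w' with [] => True | (j', _) :: _ => j <> j' /\ alternating w' end
  end.

Definition reduced_word {J : Type} (A : J -> G -> Prop) (w : list (J * G)) :=
  Forall (fun p => A (fst p) (snd p) /\ snd p <> gone G) w /\ alternating w.

Definition is_free_product {J : Type} (A : J -> G -> Prop) : Prop :=
  (forall j, is_subgroup (A j)) /\
  (forall g, exists w, reduced_word A w /\ word_prod w = g) /\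
  (forall w w', reduced_word A w -> reduced_word A w' ->
                word_prod w = word_prod w' -> w = w').

Definition conj (g x : G) : G := gmul G (ginv G x) (gmul G g x).

Definition hatG {J : Type} (A : J -> G -> Prop) (g : G) : Prop :=
  forall j x, ~ A j (conj g x).

Definition has_order (x : G) (m : nat) : Prop :=
  0 < m /\ gpow x m = gone G /\ (forall m', 0 < m' -> gpow x m' = gone G -> m <= m').

(* N(G) as an option: Some m = minimal order of a nonidentity element,
   None = no nonidentity element of finite order (N(G) = infinity). *)
Definition min_order_spec (N : option nat) : Prop :=
  match N with
  | Some m => (exists x, x <> gone G /\ has_order x m) /\
              (forall x m', x <> gone G -> has_order x m' -> m <= m')
  | None => forall x m', x <> gone G -> ~ has_order x m'
  end.

(* floor(n / N(G)), interpreted as 0 when N(G) = infinity *)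
Definition floor_div_N (n : nat) (N : option nat) : nat :=
  match N with Some m => n / m | None => 0 end.

Definition is_kGn {J : Type} (A : J -> G -> Prop) (n K : nat) : Prop :=
  (exists g, hatG A (gpow g n) /\ prod_comms K (gpow g n)) /\
  (forall g k, hatG A (gpow g n) -> prod_comms k (gpow g n) -> K <= k).

End GroupDefs.

(* Main.v *)
Require Import Defs.
From Stdlib Require Import List Arith.

(** Upper bound: for [g = [a, b] = u v] with [u = a^-1], [v = a^b] and [a] of order [N], one has
    [(u v)^m = u^m v^m] modulo [(m-1)/2] commutators for odd [m], and [u^r v^r] is a commutator.
    Inserting [(u v)^i] and [(v u)^j] with [i + j = lcm (2, N)] into the two halves of a power
    is cheaper than concatenation, and this gains one commutator for every [N] factors.

    Lower bound: let [g] be cyclically reduced with respect to [G = A * B], where [A] is one free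
    factor and [B] the product of the others. If [g^n] is a product of [k] commutators, it bounds a
    surface of genus [k] which is cut along arcs into pieces carried by [A] or by [B]; if [g] has
    length [2h], then there are [n h] arcs and at least [n h + 1 - 2 k] pieces are disks. Walking
    around a disk, the position modulo [2h] either stays constant, and then the disk has at least
    [N] sides, or it ascends somewhere. There are only [n (h - 1)] ascents, so there must be many
    disks of the first kind. Counting descents too, and (in the one remaining case) only those arcs
    that are not symmetric with respect to a suitable letter, bounds their number by
    [2 floor(n/N)]. *)

(** No topology enters: a surface is an involution on the corners of its boundary word, and its
    pieces are the cycles of a permutation. Only the inequality between disks and cuts that the
    Euler characteristic gives is carried along; other pieces contribute nothing positive to it and
    are never listed. Drawing a product of commutators leaves trivial letters and neighbours of
    equal type, so the obstacle is to remove these without spoiling the inequality; uniqueness of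
    reduced words then identifies the remaining word.

    If the theorem failed, counting ascents would leave at least [2 * q + 1] disks of constant
    position, where [q = n %/ N], and counting descents at most that many. Parity closes the gap: an
    odd number of such disks cannot be spread evenly over opposite positions, and reflecting at an
    uneven pair improves the second count by one disk.

    In the upper bound, insertions are controlled only up to conjugation. A single commutator, paid
    once at the end, absorbs all the conjugations; it accounts for the [+ 1] of the formula. *)

Module CommutatorLength.
From Stdlib Require Import Classical ClassicalEpsilon.
From mathcomp Require Import ssreflect ssrfun ssrbool eqtype ssrnat seq path div fintype bigop zify.
Require Import Defs.
Set Implicit Arguments. Unset Strict Implicit. Unset Printing Implicit Defensive.

(** * Groups, cyclic sequences and disks *)

Section GroupBasics.
Variable G : Group.
Local Notation "x ** y" := (gmul G x y) (at level 40, left associativity).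
Local Notation "x ^-" := (ginv G x) (at level 3, format "x ^-").
Local Notation e := (gone G).

Lemma gmulKV (x y : G) : x ** (x^- ** y) = y.
Proof. by rewrite gmulA gmulVr gmul1l. Qed.
Lemma gmulVK (x y : G) : x^- ** (x ** y) = y.
Proof. by rewrite gmulA gmulVl gmul1l. Qed.
Lemma gmul_eq1_inv (x y : G) : x ** y = e -> y = x^-.
Proof. by move=> h; rewrite -[y](gmulVK x) h gmul1r. Qed.
Lemma ginvK (x : G) : x^-^- = x.
Proof. by rewrite -(@gmul_eq1_inv x^- x) // gmulVl. Qed.
Lemma ginvM (x y : G) : (x ** y)^- = y^- ** x^-.
Proof. by rewrite -(@gmul_eq1_inv (x ** y) (y^- ** x^-)) // -gmulA gmulKV gmulVr. Qed.
Lemma ginv1 : e^- = e.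
Proof. by rewrite -(@gmul_eq1_inv e e) // gmul1l. Qed.

Definition gprod (s : seq G) : G := foldr (gmul G) e s.
Lemma gprod_cat s1 s2 : gprod (s1 ++ s2) = gprod s1 ** gprod s2.
Proof. by elim: s1 => [|x s IH] /=; rewrite ?gmul1l // IH gmulA. Qed.
Lemma gprod_cat1C s1 s2 : gprod (s1 ++ s2) = e -> gprod (s2 ++ s1) = e.
Proof.
by rewrite !gprod_cat => /gmul_eq1_inv ->; rewrite gmulVl.
Qed.
Lemma gprod_rev_inv (s : seq G) : gprod (rev (map (ginv G) s)) = (gprod s)^-.
Proof.
elim: s => [|x s IH] /=; first by rewrite ginv1.
by rewrite rev_cons -cats1 gprod_cat IH /= gmul1r ginvM.
Qed.
Lemma gprod_nseq n x : gprod (nseq n x) = gpow G x n.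
Proof. by elim: n => //= n ->. Qed.
End GroupBasics.

Section NextLemmas.
Variable T : eqType.
Implicit Types (l m : seq T) (x y z : T).

Lemma next_catC l m : uniq (l ++ m) -> next (l ++ m) =1 next (m ++ l).
Proof. by move=> u z; rewrite -(next_rot (size l) u) rot_size_cat. Qed.

Lemma next_inj_in l : uniq l -> injective (next l).
Proof. by move=> u; apply: can_inj (prev_next u). Qed.

Lemma next_consec l m x y : uniq (l ++ x :: y :: m) -> next (l ++ x :: y :: m) x = y.
Proof. by move=> u; rewrite next_catC //= eqxx. Qed.

(** [next_at] returns its default only behind the last entry. As [x] does not occur in the list, the
    value [x] detects exactly this case. *)
Lemma next_at_default x y0 y z p : z \in y :: p -> x \notin y :: p -> 
  next_at z y0 y p = if next_at z x y p == x then y0 else next_at z x y p.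
Proof.
elim: p y => [|y' p IH] y /=.
  by rewrite !inE => /eqP -> _; rewrite !eqxx.
rewrite inE; case: eqVneq => [-> _|zy /= zin]; rewrite !inE !negb_or.
  by case/and3P => _ /negbTE h _; rewrite eq_sym h.
by case/andP => _ xn; apply: IH; rewrite ?inE ?negb_or.
Qed.

Lemma next_del l m x z : uniq (l ++ x :: m) -> z \in l ++ m ->
  next (l ++ m) z =
  if next (l ++ x :: m) z == x then next (l ++ x :: m) x else next (l ++ x :: m) z.
Proof.
move=> u zl; have u' : uniq (l ++ m).
  by apply: subseq_uniq u; rewrite cat_subseq // subseq_cons.
rewrite (next_catC u') !(next_catC u) /=.
have {zl u'} : z \in m ++ l by rewrite mem_cat orbC -mem_cat.
have : x \notin m ++ l by move: u; rewrite uniq_catC /= => /andP [].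
case: (m ++ l) => [//|y p] xn zy.
rewrite /= eqxx.
have zx : z != x by apply: contraNneq xn => <-.
by rewrite (negbTE zx); apply: next_at_default.
Qed.
End NextLemmas.

(** * Cycles with trivial product *)

Section Disks.
Variables (G : Group) (T : eqType).
Local Notation "x ** y" := (gmul G x y) (at level 40, left associativity).
Local Notation "x ^-" := (ginv G x) (at level 3, format "x ^-").
Local Notation e := (gone G).
Implicit Types (v : T -> G) (s : T -> T) (l d : seq T) (Ds : seq (seq T)).

Definition disk v s d := [/\ d != [::], fcycle s d & gprod (map v d) = e].

Definition disk_family v s l Ds :=
  [/\ uniq (flatten Ds), {subset flatten Ds <= l} & forall d, d \in Ds -> disk v s d].

Lemma fcycle_ext s s' d : {in d, s =1 s'} -> fcycle s d -> fcycle s' d.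
Proof.
move=> h cd; have hd : all (mem d) d by apply/allP.
rewrite -(eq_in_cycle _ hd (e := frel s)) // => x y xd _ /=.
by rewrite h.
Qed.

Lemma disk_ext v v' s s' d : {in d, v =1 v'} -> {in d, s =1 s'} ->
  disk v s d -> disk v' s' d.
Proof.
move=> hv hs [d0 cd pd]; split=> //; first exact: fcycle_ext cd.
by rewrite -pd; congr gprod; apply/esym/eq_in_map.
Qed.

Lemma disk_family_ext v v' s s' l l' Ds : {in flatten Ds, v =1 v'} ->
    {in flatten Ds, s =1 s'} -> {subset flatten Ds <= l'} ->
  disk_family v s l Ds -> disk_family v' s' l' Ds.
Proof.
move=> hv hs hl [u _ h]; split=> // d dD.
have sub z : z \in d -> z \in flatten Ds by move=> zd; apply/flattenP; exists d.
by apply: disk_ext (h d dD) => z /sub; [apply: hv | apply: hs].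
Qed.

Lemma disk_family_cons v s l d Ds :
  disk_family v s l (d :: Ds) <->
  [/\ disk v s d, {subset d <= l}, uniq d, disk_family v s l Ds &
      {in d, forall z, z \notin flatten Ds}].
Proof.
split.
  case=> /=; rewrite cat_uniq => /and3P [ud /hasPn dis uD] sub h; split.
  - exact/h/mem_head.
  - by move=> z zd; apply: sub; rewrite mem_cat zd.
  - by [].
  - split=> // [z zD|d' d'D]; first by apply: sub; rewrite mem_cat zD orbT.
    by apply: h; rewrite inE d'D orbT.
  - by move=> z zd; apply/negP => zD; move: (dis _ zD); rewrite /= zd.
case=> hd sd ud [uD sD hD] dis; split=> /=.
- rewrite cat_uniq ud uD andbT /=; apply/hasPn => z zD.
  by apply/negP => /dis; rewrite zD.
- by move=> z; rewrite mem_cat => /orP [/sd|/sD].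
- by move=> d'; rewrite inE => /orP [/eqP -> //|/hD].
Qed.

Lemma disk_rot v s n d : disk v s d -> disk v s (rot n d).
Proof.
case=> d0 cd pd; split.
- by rewrite -size_eq0 size_rot size_eq0.
- by rewrite rot_cycle.
- by move: pd; rewrite -{1}(cat_take_drop n d) map_cat map_rot /rot -map_drop -map_take; 
     apply: gprod_cat1C.
Qed.

Lemma disk_family_pick v s l Ds x : disk_family v s l Ds -> x \in flatten Ds ->
  exists d Ds', [/\ disk_family v s l ((x :: d) :: Ds'), size Ds = (size Ds').+1 &
    flatten Ds =i (x :: d) ++ flatten Ds'].
Proof.
move=> + /flattenP [d dD xd].
case/splitPr: dD => D1 D2 [u sub h].
case: (rot_to xd) => i d' rd.
exists d', (D1 ++ D2); have pm : perm_eq (flatten (D1 ++ d :: D2)) (flatten ((x :: d') :: D1 ++ D2)).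
  rewrite -rd /= !flatten_cat /= perm_catCA perm_cat2r perm_sym.
  by rewrite perm_rot.
split; [split|by rewrite !size_cat /= addnS|exact: perm_mem].
- by rewrite -(perm_uniq pm).
- by move=> z; rewrite -(perm_mem pm); apply: sub.
- move=> d2; rewrite inE => /orP [/eqP ->|d2D].
    by rewrite -rd; apply/disk_rot/h; rewrite mem_cat mem_head orbT.
  by apply: h; move: d2D; rewrite !mem_cat inE => /orP [] ->; rewrite ?orbT.
Qed.

Lemma disk_family_closed v s l Ds z : disk_family v s l Ds ->
  z \in flatten Ds -> s z \in flatten Ds.
Proof.
case=> _ _ h /flattenP [d dD zd]; apply/flattenP; exists d => //.
by case: (h d dD) => _ cd _; apply: mem_fcycle.
Qed.

Lemma fpath_redirect s s' x y p z : s' x = s y -> {in p, s =1 s'} ->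
  fpath s y (rcons p z) -> fpath s' x (rcons p z).
Proof.
case: p => [|t p] /= -> // h /andP [-> /=].
elim: p t h => [|t' p IH] t h /=; first by rewrite h ?mem_head.
rewrite h ?mem_head // => /andP [-> /=]; apply: IH.
by move=> q qin; apply: h; rewrite inE qin orbT.
Qed.

(** Only a lower bound is recorded, so a cycle whose product is unknown can simply be left out of
    the family. *)
Definition disks v s l m := exists2 Ds, m <= size Ds & disk_family v s l Ds.

Lemma disks_ext v v' s s' l l' m : {in l, v =1 v'} -> {in l, s =1 s'} ->
  {subset l <= l'} -> disks v s l m -> disks v' s' l' m.
Proof.
move=> hv hs hl [Ds sz F]; exists Ds => //; have [_ sub _] := F.
by apply: disk_family_ext F => z /sub; [apply: hv|apply: hs|apply: hl].
Qed.

Lemma disks_cons v s l d m : disk v s d -> uniq d -> {in d, forall z, z \notin l} ->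
  disks v s l m -> disks v s (d ++ l) m.+1.
Proof.
move=> hd ud dl [Ds sz F]; exists (d :: Ds) => //; apply/disk_family_cons; split=> //.
- by move=> z zd; rewrite mem_cat zd.
- have [_ sub _] := F; apply: disk_family_ext F => // z /sub.
  by rewrite mem_cat orbC => ->.
- by move=> z /dl; apply: contra => zD; case: F => _ + _; apply.
Qed.

(* Composing with a transposition merges or splits cycles and costs at most one disk. *)
Lemma disks_transp v s s' l x y m : x != y -> s' x = s y -> s' y = s x ->
    {in l, forall z, z != x -> z != y -> s' z = s z} ->
  disks v s l m -> disks v s' l m.-1.
Proof.
move=> xy sx sy h [Ds sz F].
have keep Ds' : disk_family v s l Ds' -> x \notin flatten Ds' -> y \notin flatten Ds' ->
  disk_family v s' l Ds'.
  move=> F' xD yD; have [_ sub _] := F'; apply: disk_family_ext F' => // z zD.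
  apply/esym/h; first exact: sub.
    by apply: contraNneq xD => <-.
  by apply: contraNneq yD => <-.
(* If [x] and [y] lie on two different listed disks, these merge into one. In all other cases at
   most one listed disk meets [x] or [y], and it is dropped. *)
have [xD|xD] := boolP (x \in flatten Ds); last first.
  have [yD|yD] := boolP (y \in flatten Ds); last by exists Ds; [lia|apply: keep].
  have [d [Ds' [F' sz' mD]]] := disk_family_pick F yD.
  have [_ _ _ F'' dis] := (disk_family_cons v s l (y :: d) Ds').1 F'.
  exists Ds'; first by lia.
  apply: keep => //; last by apply: dis; apply: mem_head.
  by apply: contra xD => xD'; rewrite mD mem_cat xD' orbT.
have [d [Ds' [F' sz' mD]]] := disk_family_pick F xD.
have [hd sd ud F'' dis] := (disk_family_cons v s l (x :: d) Ds').1 F'.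
have xD' : x \notin flatten Ds' by apply: dis; apply: mem_head.
have [yD|yD] := boolP (y \in flatten Ds'); last by exists Ds'; [lia|apply: keep].
have [d2 [Ds2 [F2 sz2 mD2]]] := disk_family_pick F'' yD.
have [hd2 sd2 ud2 F3 dis2] := (disk_family_cons v s l (y :: d2) Ds2).1 F2.
have disj z : z \in x :: d -> z \notin y :: d2.
  by move=> /dis; rewrite mD2 mem_cat; apply: contra => ->.
have disj' z : z \in y :: d2 -> z \notin x :: d.
  by move=> zy; apply/negP => /disj; rewrite zy.
exists ((x :: d2 ++ y :: d) :: Ds2); first by rewrite /=; lia.
apply/disk_family_cons.
have pm : perm_eq (x :: d2 ++ y :: d) ((x :: d) ++ (y :: d2)).
  by apply/permP => a; rewrite /= !count_cat /=; lia.
have sub z : z \in x :: d2 ++ y :: d -> z \in x :: d \/ z \in y :: d2.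
  by rewrite (perm_mem pm) mem_cat => /orP [] ->; [left|right].
have hs z : z \in d \/ z \in d2 -> s z = s' z.
  move=> zd; apply/esym/h.
  - by case: zd => zd; [apply: sd|apply: sd2]; rewrite inE zd orbT.
  - case: zd => zd.
      by apply: contraTneq zd => ->; case/andP: ud.
    apply: contraTneq zd => ->; have := disj x (mem_head _ _).
    by rewrite inE negb_or => /andP [].
  - case: zd => zd; last by apply: contraTneq zd => ->; case/andP: ud2.
    apply: contraTneq zd => ->; have := disj' y (mem_head _ _).
    by rewrite inE negb_or => /andP [].
split.
- case: hd => _ cd pd; case: hd2 => _ cd2 pd2; split=> //.
    rewrite /cycle rcons_cat -cat_rcons cat_path last_rcons.
    apply/andP; split.
      by apply: fpath_redirect sx _ cd2 => z zd; apply: hs; right.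
    by apply: fpath_redirect sy _ cd => z zd; apply: hs; left.
  move: pd pd2; rewrite /= map_cat gprod_cat /= => /gmul_eq1_inv -> /gmul_eq1_inv ->.
  by rewrite !gmulA -[_ ** _ ** v y]gmulA gmulVl gmul1r gmulVr.
- by move=> z /sub [/sd|/sd2].
- rewrite (perm_uniq pm) cat_uniq ud ud2 andbT andTb.
  by apply/hasPn => z /disj'.
- apply: keep => //; last by apply: dis2; apply: mem_head.
  by apply: contra xD' => xD2; rewrite mD2 mem_cat xD2 orbT.
- move=> z /sub [/dis|/dis2 //].
  by rewrite mD2 mem_cat; apply: contra => ->; rewrite orbT.
Qed.

Lemma fpath_skip s s' x y t p : x \notin p ->
    {in t :: p, forall z, s' z = if s z == x then y else s z} ->
  fpath s t (rcons p x) -> fpath s' t (rcons p y).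
Proof.
elim: p t => [|t' p IH] t xn h /=; rewrite h ?mem_head //.
  by case/andP => ->; rewrite eqxx.
case/andP => /eqP -> pp; move: xn; rewrite inE negb_or => /andP [xt xn].
rewrite [t' == x]eq_sym (negbTE xt) eqxx /=; apply: IH => // z zin.
by apply: h; rewrite inE zin orbT.
Qed.

(** The value of [x] is passed on to its successor, so the cycle keeps its product. Injectivity of
    [s] ensures that a disk through [y] also passes through [x]; hence the change of value at [y]
    affects no other disk. *)
Lemma disks_del v v' s s' l l' x y m : y = s x -> y != x -> {in l &, injective s} ->
    x \in l -> (forall z, z \in l -> z != x -> z \in l') ->
    v' y = v x ** v y -> {in l, forall z, z != y -> v' z = v z} ->
    {in l, forall z, z != x -> s' z = if s z == x then y else s z} ->
  disks v s l m -> disks v' s' l' m.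
Proof.
move=> yE yx inj xl ll' vy hv hs [Ds sz F].
have keep Ds' : disk_family v s l Ds' -> x \notin flatten Ds' ->
  disk_family v' s' l' Ds'.
  move=> F' xD; have [u sub hD] := F'.
  have ne z : z \in flatten Ds' -> z != x by move=> zD; apply: contraNneq xD => <-.
  have sne z : z \in flatten Ds' -> s z != x.
    by move=> zD; apply: ne; apply: disk_family_closed F' _.
  apply: disk_family_ext F' => z zD.
  - apply/esym/hv; first exact: sub.
    apply: contraNneq xD => zy.
    have /flattenP [d dD zd] := zD.
    have [_ cd _] := hD d dD; have := mem_prev d z; rewrite zd => pz.
    have spz : s (prev d z) = z.
      have := prev_cycle cd zd; exact: eqP.
    apply/flattenP; exists d => //.
    rewrite -(inj (prev d z) x) //; last by rewrite spz zy.
    by apply/sub/flattenP; exists d.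
  - by rewrite hs ?ne ?sub // (negbTE (sne z zD)).
  - by apply: ll'; [apply: sub|apply: ne].
have [xD|xD] := boolP (x \in flatten Ds); last by exists Ds => //; apply: keep.
have [d [Ds' [F' sz' mD]]] := disk_family_pick F xD.
have [hd sd ud F'' dis] := (disk_family_cons v s l (x :: d) Ds').1 F'.
case: hd => _ cd pd.
case: d cd pd sd ud dis {F' mD} => [|t d] cd pd sd ud dis.
  by move: cd; rewrite /= -yE (negbTE yx).
have ty : t = y by move: cd; rewrite /= -yE => /andP [/eqP].
subst t; have xn : x \notin y :: d by case/andP: ud.
exists ((y :: d) :: Ds'); first by rewrite /=; lia.
apply/disk_family_cons; split.
- split=> //.
    move: cd; rewrite /= => /andP [_]; apply: fpath_skip => [|z zd].
      by move: xn; rewrite inE negb_or => /andP [].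
    apply: hs; first by apply: sd; rewrite inE zd orbT.
    by apply: contraNneq xn => <-.
  rewrite /= vy -pd /= -gmulA; congr (_ ** (_ ** gprod _)).
  apply/eq_in_map => z zd; apply: hv; first by apply: sd; rewrite !inE zd !orbT.
  by apply: contraTneq zd => ->; case/and3P: ud.
- move=> z zd; apply: ll'; first by apply: sd; rewrite inE zd orbT.
  by apply: contraNneq xn => <-.
- by case/andP: ud.
- by apply: keep => //; apply: dis; apply: mem_head.
- by move=> z zd; apply: dis; rewrite inE zd orbT.
Qed.

Lemma disks_del_fix v s l l' x m : s x = x -> (forall z, z \in l -> z != x -> z \in l') ->
  disks v s l m -> disks v s l' m.-1.
Proof.
move=> sx ll' [Ds sz F].
have keep Ds' : disk_family v s l Ds' -> x \notin flatten Ds' -> disk_family v s l' Ds'.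
  move=> F' xD; have [_ sub _] := F'; apply: disk_family_ext F' => // z zD.
  by apply: ll'; [apply: sub|apply: contraNneq xD => <-].
have [xD|xD] := boolP (x \in flatten Ds); last by exists Ds; [lia|apply: keep].
have [d [Ds' [F' sz' mD]]] := disk_family_pick F xD.
have [_ _ _ F'' dis] := (disk_family_cons v s l (x :: d) Ds').1 F'.
by exists Ds'; [lia|apply: keep => //; apply: dis; apply: mem_head].
Qed.

(** Trivial letters spliced into a cycle in front of [h] do not change its product. *)
Lemma disks_ins v s s' l us u h m : h \in l -> uniq (u :: us) ->
    {in u :: us, forall z, z \notin l /\ v z = e} ->
    fpath s' u (rcons us h) ->
    {in l, forall z, s' z = if s z == h then u else s z} ->
  disks v s l m -> disks v s' (u :: us ++ l) m.
Proof.
move=> hl uu un pu hs [Ds sz F].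
have keep Ds' : disk_family v s l Ds' -> h \notin flatten Ds' ->
    disk_family v s' (u :: us ++ l) Ds'.
  move=> F' xD; have [_ sub _] := F'.
  have clo := disk_family_closed F'.
  apply: disk_family_ext F' => // z zD.
    rewrite hs ?sub // ifN //.
    by apply: contraNneq xD => <-; apply: clo.
  by rewrite -cat_cons mem_cat (sub z) ?orbT.
have [xD|xD] := boolP (h \in flatten Ds); last by exists Ds => //; apply: keep.
have [d [Ds' [F' sz' mD]]] := disk_family_pick F xD.
have [[_ cd pd] sd ud F'' dis] := (disk_family_cons v s l (h :: d) Ds').1 F'.
exists ((u :: us ++ h :: d) :: Ds'); first by rewrite /=; lia.
apply/disk_family_cons; split.
- split=> //.
    rewrite /cycle rcons_cat -cat_rcons cat_path pu last_rcons /=.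
    apply: fpath_skip cd; first by case/andP: ud.
    by move=> z /sd; apply: hs.
  rewrite -cat_cons map_cat gprod_cat pd gmul1r.
  have {uu pu}: {in u :: us, forall z, v z = e} by move=> z /un [].
  elim: (u :: us) => //= t p IH H; rewrite H ?mem_head // gmul1l; apply: IH.
  by move=> z zin; apply: H; rewrite inE zin orbT.
- by move=> z; rewrite -!cat_cons !mem_cat => /orP [->//|/sd ->]; rewrite orbT.
- rewrite -cat_cons cat_uniq uu ud andbT andTb; apply/hasPn => z /sd zl.
  by apply/negP => /un []; rewrite zl.
- by apply: keep => //; apply: dis; apply: mem_head.
- move=> z; rewrite -cat_cons mem_cat => /orP [/un [zl _]|/dis //].
  by apply: contra zl; case: F'' => _ + _; apply.
Qed.
End Disks.

(** * Surface diagrams *)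

Definition moved (rho : nat -> nat) (l : seq nat) := count (fun z => rho z != z) l.
Arguments moved : simpl never.

Section Diagrams.
Variable G : Group.
Local Notation "x ** y" := (gmul G x y) (at level 40, left associativity).
Local Notation "x ^-" := (ginv G x) (at level 3, format "x ^-").
Local Notation e := (gone G).
Implicit Types (lam : nat -> bool * G) (rho : nat -> nat) (l : seq nat).

(* A surface bounded by the cyclic word [l], whose letter [z] has type [(lam z).1] and value
   [(lam z).2]. A cut joins the corner behind [z] to the corner behind [rho z] ([rho z = z] means
   that there is no cut behind [z]); [next l \o rho] then walks around the resulting pieces, each
   of which carries letters of a single type, and [m] bounds from below the number of pieces with
   trivial boundary value. *)
Definition diagram l lam rho m :=
  [/\ uniq l, {in l, forall x, rho x \in l /\ rho (rho x) = x},
      {in l, forall x, (lam (next l (rho x))).1 = (lam x).1} &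
      disks (fun z => (lam z).2) (next l \o rho) l m].

Lemma diagram_step_inj l lam rho m : diagram l lam rho m ->
  {in l &, injective (next l \o rho)}.
Proof.
case=> u inv _ _ x y xl yl /= /(next_inj_in u) xy.
by have [_ <-] := inv x xl; rewrite xy; have [_ ->] := inv y yl.
Qed.

Lemma count_but1 (P Q : pred nat) l a : uniq l -> a \in l ->
  {in l, forall z, z != a -> P z = Q z} -> count P l + Q a = count Q l + P a.
Proof.
move=> u al h; have pm := perm_to_rem al.
rewrite (permP pm P) (permP pm Q) /=.
have -> : count P (rem a l) = count Q (rem a l); last by lia.
apply: eq_in_count => z; rewrite mem_rem_uniq // inE => /andP [za zl]; exact: h.
Qed.

Lemma count_but2 (P Q : pred nat) l a b : uniq l -> a \in l -> b \in l -> a != b ->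
  {in l, forall z, z != a -> z != b -> P z = Q z} ->
  count P l + Q a + Q b = count Q l + P a + P b.
Proof.
move=> u al bl ab h.
pose R z := if z == a then Q z else P z.
have h1 : count P l + R a = count R l + P a.
  by apply: count_but1 => // z _ /negbTE za; rewrite /R za.
have h2 : count R l + Q b = count Q l + R b.
  apply: count_but1 => // z zl zb; rewrite /R; case: eqVneq => // za; exact: h.
by move: h1 h2; rewrite /R eqxx eq_sym (negbTE ab); lia.
Qed.

(** Removing a cut lowers [moved] by 2 and changes the walk by a transposition, which costs at most
    one disk; so [2 * m - moved] does not drop. The type condition at [x] implies the one at the
    other end of the cut. *)
Lemma diagram_uncut l lam rho m x : diagram l lam rho m -> x \in l ->
    (lam (next l x)).1 = (lam x).1 ->
  exists rho' m', [/\ diagram l lam rho' m', rho' x = x &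
    moved rho' l + 2 * m <= moved rho l + 2 * m'].
Proof.
move=> Dg xl tx; have [u inv ty ds] := Dg.
have [rx|rx] := eqVneq (rho x) x; first by exists rho, m; split.
have [pl rp] := inv x xl; set p := rho x in rx pl rp.
pose rho' z := if (z == x) || (z == p) then z else rho z.
have r'x : rho' x = x by rewrite /rho' eqxx.
have r'p : rho' p = p by rewrite /rho' eqxx orbT.
have tp : (lam p).1 = (lam x).1 by rewrite -(ty p pl) rp.
exists rho', m.-1; split=> //.
- split=> //.
  + move=> z zl; rewrite /rho'; case: ifP => [->//|/negbT].
    rewrite negb_or => /andP [zx zp]; have [rl rr] := inv z zl; split=> //.
    have -> : rho z == x = false.
      by apply/negbTE; apply: contraNneq zp => rzx; rewrite /p -rzx rr.
    have -> // : rho z == p = false.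
    by apply/negbTE; apply: contraNneq zx => rzx; rewrite -rp -rzx rr.
  + move=> z zl; rewrite /rho'; case: ifP => [/orP [/eqP ->|/eqP ->]|_] //.
      by rewrite tp; apply: ty.
    exact: ty.
  + apply: (disks_transp (x := x) (y := p)) ds; first by rewrite eq_sym.
    * by rewrite /= r'x rp.
    * by rewrite /= r'p.
    * by move=> z zl /negbTE zx /negbTE zp; rewrite /= /rho' zx zp.
have xp : x != p by rewrite eq_sym.
have H : moved rho' l + (rho x != x) + (rho p != p) = moved rho l + (rho' x != x) + (rho' p != p).
  by apply: count_but2 => // z zl /negbTE zx /negbTE zp; rewrite /rho' zx zp.
by move: H; rewrite r'x r'p rp xp !eqxx -/p rx /=; lia.
Qed.

Lemma next_neq l1 x l2 : uniq (l1 ++ x :: l2) -> l1 ++ l2 != [::] ->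
  next (l1 ++ x :: l2) x != x.
Proof.
move=> u ne; rewrite next_catC //=; move: u; rewrite uniq_catC /= => /andP [xn _].
have : l2 ++ l1 != [::] by rewrite -size_eq0 size_cat addnC -size_cat size_eq0.
case: (l2 ++ l1) xn => // y p; rewrite inE negb_or /= eqxx => /andP [+ _] _.
by rewrite eq_sym.
Qed.

Lemma mem_del l1 (x : nat) l2 z : uniq (l1 ++ x :: l2) ->
  (z \in l1 ++ l2) = (z \in l1 ++ x :: l2) && (z != x).
Proof.
rewrite uniq_catC /= mem_cat negb_or => /andP [/andP [x2 x1] _].
rewrite !mem_cat inE; case: (eqVneq z x) => [->|]; last by rewrite andbT.
by rewrite (negbTE x1) (negbTE x2) andbF.
Qed.

Lemma uniq_del l1 (x : nat) l2 : uniq (l1 ++ x :: l2) -> uniq (l1 ++ l2).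
Proof. by apply: subseq_uniq; rewrite cat_subseq // subseq_cons. Qed.

Lemma count_del (P : pred nat) l1 x l2 :
  count P (l1 ++ x :: l2) = P x + count P (l1 ++ l2).
Proof. by rewrite !count_cat /=; lia. Qed.

(** Without a cut behind [x], the walk goes from [x] straight to [y], so that [y] can absorb the
    value of [x]. *)
Lemma diagram_del_fix l1 x l2 lam rho m : diagram (l1 ++ x :: l2) lam rho m ->
    rho x = x -> l1 ++ l2 != [::] ->
  let y := next (l1 ++ x :: l2) x in
  let lam' z := if z == y then ((lam z).1, (lam x).2 ** (lam z).2) else lam z in
  diagram (l1 ++ l2) lam' rho m /\ moved rho (l1 ++ l2) = moved rho (l1 ++ x :: l2).
Proof.
move=> Dg rx ne y lam'; have [u inv ty ds] := Dg.
have yx : y != x by apply: next_neq.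
have xl : x \in l1 ++ x :: l2 by rewrite mem_cat mem_head orbT.
have tx : (lam y).1 = (lam x).1 by rewrite -(ty x xl) rx.
have lam1 z : (lam' z).1 = (lam z).1 by rewrite /lam'; case: ifP.
have inv' : {in l1 ++ l2, forall z, rho z \in l1 ++ l2 /\ rho (rho z) = z}.
  move=> z; rewrite (mem_del _ u) => /andP [zl zx]; have [rl rr] := inv z zl.
  rewrite (mem_del _ u) rl rr; split=> //=.
  by apply: contraNneq zx => rzx; rewrite -rr rzx rx.
split; last by rewrite /moved count_del rx eqxx.
split=> //; first exact: uniq_del u.
  move=> z zl; rewrite !lam1 (next_del u); last by have [] := inv' z zl.
  have zl' : z \in l1 ++ x :: l2 by move: zl; rewrite (mem_del _ u) => /andP [].
  case: ifP => [/eqP nx|_]; last exact: ty.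
  by rewrite -(ty z zl') nx -/y.
apply: (disks_del (x := x) (y := y)) ds => //=.
- by rewrite rx.
- exact: diagram_step_inj Dg.
- by move=> z zl zx; rewrite (mem_del _ u) zl.
- by rewrite /lam' eqxx.
- by move=> z _ /negbTE zy; rewrite /lam' zy.
- move=> z zl zx; rewrite (next_del u) //.
  by have [] // := inv' z; rewrite (mem_del _ u) zl.
Qed.


(* The neighbour before [r] is not cut off from it, hence takes over the cut behind [r]. *)
Lemma diagram_del_triv_uncut l1 r l2 lam rho m x1 : let l := l1 ++ r :: l2 in
    next l x1 = r -> diagram l lam rho m -> (lam r).2 = e -> l1 ++ l2 != [::] ->
    rho x1 = x1 -> rho r != r ->
  exists rho', diagram (l1 ++ l2) lam rho' m /\ moved rho' (l1 ++ l2) = moved rho l.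
Proof.
move=> l nx1 Dg r1 ne; have [u inv ty ds] := Dg.
have memd z : z \in l1 ++ l2 = (z \in l) && (z != r) := mem_del z u.
have u' : uniq (l1 ++ l2) := uniq_del u.
have rl : r \in l by rewrite mem_cat mem_head orbT.
have nr : next l r != r by apply: next_neq.
have x1l : x1 \in l by rewrite -mem_next nx1.
have x1r : x1 != r by apply: contraNneq nr => x1r; rewrite -{1}x1r nx1.
have x1l' : x1 \in l1 ++ l2 by rewrite memd x1l.
have nd z : z \in l1 ++ l2 -> next (l1 ++ l2) z = if z == x1 then next l r else next l z.
  by move=> zl; rewrite (next_del u) // -/l -[r in _ == r]nx1 (inj_eq (next_inj_in u)).
have nrE z : (next l z == r) = (z == x1) by rewrite -[r in _ == r]nx1 (inj_eq (next_inj_in u)).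
have cd : moved rho l = (rho r != r) + moved rho (l1 ++ l2) := count_del _ _ _ _.

move=> rx1 rr; have [ql rq] := inv r rl; set q := rho r in rr ql rq.
have qx1 : q != x1 by apply: contraNneq x1r => qx; rewrite -rq qx rx1.
have ql' : q \in l1 ++ l2 by rewrite memd ql.
pose rho' z := if z == x1 then q else if z == q then x1 else rho z.
have r'x1 : rho' x1 = q by rewrite /rho' eqxx.
have r'q : rho' q = x1 by rewrite /rho' (negbTE qx1) eqxx.
have r'z z : z != x1 -> z != q -> rho' z = rho z.
  by rewrite /rho' => /negbTE -> /negbTE ->.
have rz z : z \in l -> z != x1 -> z != q -> z != r -> [/\ rho z != x1, rho z != r & rho z != q].
  move=> zl zx zq zr; have [_ rrz] := inv z zl; split.
  - by apply: contraNneq zx => h; rewrite -rrz h rx1.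
  - by apply: contraNneq zq => h; rewrite -rrz h.
  - by apply: contraNneq zr => h; rewrite -rrz h rq.
exists rho'; split; last first.
  have : moved rho' (l1 ++ l2) + (rho x1 != x1) = moved rho (l1 ++ l2) + (rho' x1 != x1).
    apply: count_but1 => // z zl zx; case: (eqVneq z q) => [->|zq]; last by rewrite r'z.
    by rewrite r'q rq eq_sym qx1 eq_sym rr.
  by rewrite cd -/q rr r'x1 rx1 eqxx qx1 /=; clear; lia.
have inv' : {in l1 ++ l2, forall z, rho' z \in l1 ++ l2 /\ rho' (rho' z) = z}.
  move=> z; case: (eqVneq z x1) => [-> _|zx]; first by rewrite r'x1 r'q.
  case: (eqVneq z q) => [-> _|zq]; first by rewrite r'q r'x1.
  rewrite memd => /andP [zl zr]; have [h1 h2 h3] := rz z zl zx zq zr.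
  by have [rzl rrz] := inv z zl; rewrite r'z // memd rzl h2 r'z.
split=> //.
- move=> z zl'; have [rl' _] := inv' z zl'; rewrite nd //.
  case: (eqVneq z x1) => [->|zx].
    rewrite r'x1 (negbTE qx1) -[q]/(rho r) ty // -nx1 -{1}rx1; exact: ty.
  case: (eqVneq z q) => [->|zq]; first by rewrite r'q eqxx -{1}rq ty.
  move: zl'; rewrite memd => /andP [zl zr]; have [h1 h2 h3] := rz z zl zx zq zr.
  by rewrite r'z // (negbTE h1); apply: ty.
apply: (disks_del (x := r) (y := next l q)) ds => //=.
- by rewrite nrE.
- exact: diagram_step_inj Dg.
- by move=> z zl zr; rewrite memd zl.
- by rewrite r1 gmul1l.
move=> z zl zr; have zl' : z \in l1 ++ l2 by rewrite memd zl.
have [rl' _] := inv' z zl'; rewrite nd // nrE.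
case: (eqVneq z x1) => [->|zx]; first by rewrite r'x1 (negbTE qx1) rx1 eqxx.
case: (eqVneq z q) => [->|zq]; first by rewrite r'q eqxx rq eq_sym (negbTE x1r).
by have [h1 h2 h3] := rz z zl zx zq zr; rewrite r'z // (negbTE h1).
Qed.

Lemma diagram_del_triv_cut l1 r l2 lam rho m x1 : let l := l1 ++ r :: l2 in
    next l x1 = r -> diagram l lam rho m -> (lam r).2 = e -> l1 ++ l2 != [::] ->
    (lam (next l r)).1 = (lam x1).1 -> rho x1 != x1 -> rho r != r ->
  exists rho', diagram (l1 ++ l2) lam rho' m.-1 /\ moved rho' (l1 ++ l2) + 2 = moved rho l.
Proof.
move=> l nx1 Dg r1 ne; have [u inv ty ds] := Dg.
have memd z : z \in l1 ++ l2 = (z \in l) && (z != r) := mem_del z u.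
have u' : uniq (l1 ++ l2) := uniq_del u.
have rl : r \in l by rewrite mem_cat mem_head orbT.
have nr : next l r != r by apply: next_neq.
have x1l : x1 \in l by rewrite -mem_next nx1.
have x1r : x1 != r by apply: contraNneq nr => x1r; rewrite -{1}x1r nx1.
have x1l' : x1 \in l1 ++ l2 by rewrite memd x1l.
have nd z : z \in l1 ++ l2 -> next (l1 ++ l2) z = if z == x1 then next l r else next l z.
  by move=> zl; rewrite (next_del u) // -/l -[r in _ == r]nx1 (inj_eq (next_inj_in u)).
have nrE z : (next l z == r) = (z == x1) by rewrite -[r in _ == r]nx1 (inj_eq (next_inj_in u)).
have cd : moved rho l = (rho r != r) + moved rho (l1 ++ l2) := count_del _ _ _ _.

move=> tx rx1 rr; have [ql rq] := inv r rl; set q := rho r in rr ql rq.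
(* Here a single cut separates [r] from everything else: [r] is a piece by itself, and is given up
   together with the cut. *)
have [qx1|qx1] := eqVneq q x1.
  pose rho' z := if z == x1 then x1 else rho z.
  have rx1E : rho x1 = r by rewrite -qx1.
  have r'x1 : rho' x1 = x1 by rewrite /rho' eqxx.
  have r'z z : z != x1 -> rho' z = rho z by rewrite /rho' => /negbTE ->.
  have rz z : z \in l -> z != x1 -> z != r -> rho z != x1 /\ rho z != r.
    move=> zl zx zr; have [_ rrz] := inv z zl; split.
      by apply: contraNneq zr => h; rewrite -rrz h rx1E.
    by apply: contraNneq zx => h; rewrite -rrz h -qx1.
  exists rho'; split; last first.
    have : moved rho' (l1 ++ l2) + (rho x1 != x1) = moved rho (l1 ++ l2) + (rho' x1 != x1).
      by apply: count_but1 => // z zl zx; rewrite r'z.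
    by rewrite cd -/q rr r'x1 rx1 eqxx /=; clear; lia.
  have inv' : {in l1 ++ l2, forall z, rho' z \in l1 ++ l2 /\ rho' (rho' z) = z}.
    move=> z; case: (eqVneq z x1) => [-> _|zx]; first by rewrite !r'x1.
    rewrite memd => /andP [zl zr]; have [h1 h2] := rz z zl zx zr.
    by have [rzl rrz] := inv z zl; rewrite r'z // memd rzl h2 r'z.
  have same z : z \in l1 ++ l2 -> next (l1 ++ l2) (rho' z) = next l (rho z).
    move=> zl'; have [rl' _] := inv' z zl'; rewrite nd //.
    case: (eqVneq z x1) => [->|zx]; first by rewrite r'x1 eqxx rx1E.
    move: zl'; rewrite memd => /andP [zl zr]; have [h1 h2] := rz z zl zx zr.
    by rewrite r'z // (negbTE h1).
  split=> //.
    move=> z zl'; rewrite same //; apply: ty.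
    by move: zl'; rewrite memd => /andP [].
  have : disks (fun z => (lam z).2) (next l \o rho) (l1 ++ l2) m.-1.
    apply: (disks_del_fix (x := r)) ds; first by rewrite /= -/q qx1.
    by move=> z zl zr; rewrite memd zl.
  by apply: disks_ext => // z zl' /=; rewrite same.
have [pl rp] := inv x1 x1l; set p := rho x1 in rx1 pl rp.
have pr : p != r by apply: contraNneq qx1 => h; rewrite /q -h rp.
have pq : p != q by apply: contraNneq x1r => h; rewrite -rp h rq.
have ql' : q \in l1 ++ l2 by rewrite memd ql.
have pl' : p \in l1 ++ l2 by rewrite memd pl.
(* The two cuts ending on either side of [r] become one cut from [p] to [q], and the corner behind
   [x1] is left uncut. *)
pose rho' z := if z == x1 then x1 else if z == p then q else if z == q then p else rho z.
have r'x1 : rho' x1 = x1 by rewrite /rho' eqxx.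
have r'p : rho' p = q by rewrite /rho' (negbTE rx1) eqxx.
have r'q : rho' q = p by rewrite /rho' (negbTE qx1) eq_sym (negbTE pq) eqxx.
have r'z z : z != x1 -> z != p -> z != q -> rho' z = rho z.
  by rewrite /rho' => /negbTE -> /negbTE -> /negbTE ->.
have rz z : z \in l -> z != x1 -> z != p -> z != q -> z != r ->
    [/\ rho z != x1, rho z != r, rho z != q & rho z != p].
  move=> zl zx zp zq zr; have [_ rrz] := inv z zl; split.
  - by apply: contraNneq zp => h; rewrite -rrz h.
  - by apply: contraNneq zq => h; rewrite -rrz h.
  - by apply: contraNneq zr => h; rewrite -rrz h rq.
  - by apply: contraNneq zx => h; rewrite -rrz h rp.
exists rho'; split; last first.
  have : moved rho' (l1 ++ l2) + (rho x1 != x1) = moved rho (l1 ++ l2) + (rho' x1 != x1).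
    apply: count_but1 => // z zl zx.
    case: (eqVneq z p) => [->|zp]; first by rewrite r'p rp eq_sym pq eq_sym rx1.
    case: (eqVneq z q) => [->|zq]; first by rewrite r'q rq pq eq_sym rr.
    by rewrite r'z.
  by rewrite cd -/q rr r'x1 -/p rx1 eqxx /=; clear; lia.
have inv' : {in l1 ++ l2, forall z, rho' z \in l1 ++ l2 /\ rho' (rho' z) = z}.
  move=> z; case: (eqVneq z x1) => [-> _|zx]; first by rewrite !r'x1.
  case: (eqVneq z p) => [-> _|zp]; first by rewrite r'p r'q.
  case: (eqVneq z q) => [-> _|zq]; first by rewrite r'q r'p.
  rewrite memd => /andP [zl zr]; have [h1 h2 h3 h4] := rz z zl zx zp zq zr.
  by have [rzl rrz] := inv z zl; rewrite r'z // memd rzl h2 r'z.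
split=> //.
- move=> z zl'; have [rl' _] := inv' z zl'; rewrite nd //.
  case: (eqVneq z x1) => [->|zx]; first by rewrite r'x1 eqxx.
  case: (eqVneq z p) => [->|zp].
    by rewrite r'p (negbTE qx1) -[q]/(rho r) ty // -(ty p pl) rp nx1.
  case: (eqVneq z q) => [->|zq].
    by rewrite r'q (negbTE rx1) -[p]/(rho x1) ty // -tx -{1}rq ty.
  move: zl'; rewrite memd => /andP [zl zr]; have [h1 h2 h3 h4] := rz z zl zx zp zq zr.
  by rewrite r'z // (negbTE h1); apply: ty.
(* [s1] is the old walk with [r] skipped, which costs no disk; the new walk differs from it by a
   transposition of [x1] and [q]. *)
pose s1 z := if next l (rho z) == r then next l q else next l (rho z).
have : disks (fun z => (lam z).2) s1 (l1 ++ l2) m.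
  apply: (disks_del (x := r) (y := next l q)) ds => //=.
  - by rewrite nrE.
  - exact: diagram_step_inj Dg.
  - by move=> z zl zr; rewrite memd zl.
  - by rewrite r1 gmul1l.
apply: (disks_transp (x := x1) (y := q)); first by rewrite eq_sym.
- by rewrite /= r'x1 nd // eqxx /s1 rq (negbTE nr).
- by rewrite /= r'q nd // (negbTE rx1) /s1 -/p nrE (negbTE rx1).
move=> z zl' zx zq; have [rl' _] := inv' z zl'; rewrite /= nd // /s1 nrE.
case: (eqVneq z p) => [->|zp]; first by rewrite r'p (negbTE qx1) rp eqxx.
move: zl'; rewrite memd => /andP [zl zr]; have [h1 h2 h3 h4] := rz z zl zx zp zq zr.
by rewrite r'z // (negbTE h1).
Qed.

Lemma diagram_del_triv l1 r l2 lam rho m : diagram (l1 ++ r :: l2) lam rho m ->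
    (lam r).2 = e -> l1 ++ l2 != [::] ->
  exists rho' m', diagram (l1 ++ l2) lam rho' m' /\
    moved rho' (l1 ++ l2) + 2 * m <= moved rho (l1 ++ r :: l2) + 2 * m'.
Proof.
move=> Dg r1 ne; have [u _ _ _] := Dg.
have rl : r \in l1 ++ r :: l2 by rewrite mem_cat mem_head orbT.
have del_fix rho0 m0 : diagram (l1 ++ r :: l2) lam rho0 m0 -> rho0 r = r ->
    diagram (l1 ++ l2) lam rho0 m0 /\ moved rho0 (l1 ++ l2) = moved rho0 (l1 ++ r :: l2).
  move=> Dg0 rr; have [[A B C D] mv] := diagram_del_fix Dg0 rr ne; split=> //.
  split=> // [z zl|]; first by have := C z zl; do 2!case: ifP.
  by apply: disks_ext D => // z zl' /=; case: ifP => // _; rewrite /= r1 gmul1l.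
set x1 := prev (l1 ++ r :: l2) r.
have nx1 : next (l1 ++ r :: l2) x1 = r by exact: (next_prev u).
have x1l : x1 \in l1 ++ r :: l2 by rewrite mem_prev.
have [t2|t2] := eqVneq (lam (next (l1 ++ r :: l2) r)).1 (lam r).1.
  have [rho1 [m1 [Dg1 rr mv1]]] := diagram_uncut Dg rl t2.
  have [Dg2 mv2] := del_fix _ _ Dg1 rr.
  by exists rho1, m1; rewrite mv2.
have rr rho0 m0 : diagram (l1 ++ r :: l2) lam rho0 m0 -> rho0 r != r.
  by case=> _ _ ty _; apply: contraNneq t2 => rr; have := ty r rl; rewrite rr => ->.
have [t1|t1] := eqVneq (lam r).1 (lam x1).1.
  have [rho1 [m1 [Dg1 rx mv1]]] := diagram_uncut Dg x1l (etrans (congr1 (fun z => (lam z).1) nx1) t1).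
  have [rho2 [Dg2 mv2]] := diagram_del_triv_uncut nx1 Dg1 r1 ne rx (rr _ _ Dg1).
  by exists rho2, m1; rewrite mv2.
have [|||rho' [Dg' mv]] := diagram_del_triv_cut nx1 Dg r1 ne.
(* Both neighbours differ in type from [r]. There being only two types, they agree. *)
- by move: t1 t2; case: (lam r).1; case: (lam x1).1; case: (lam _).1.
- case: Dg => _ _ ty _; apply: contraNneq t1 => rx.
  by have := ty x1 x1l; rewrite rx nx1 => ->.
- exact: rr Dg.
by exists rho', m.-1; split=> //; lia.
Qed.
End Diagrams.

(** * Drawing a product of commutators *)

Section Drawings.
Variable G : Group.
Local Notation "x ** y" := (gmul G x y) (at level 40, left associativity).
Local Notation "x ^-" := (ginv G x) (at level 3, format "x ^-").
Local Notation e := (gone G).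
Implicit Types (lam : nat -> bool * G) (rho : nat -> nat) (l : seq nat) (w x : seq (bool * G)).

Lemma fresh_nat l : exists b, {in l, forall z, z < b}.
Proof.
elim: l => [|a l [b hb]]; first by exists 0.
exists (maxn a.+1 b) => z; rewrite inE => /orP [/eqP ->|/hb]; lia.
Qed.

Lemma next_prefix4 z0 z1 z2 z3 (h : nat) l z : uniq (z0 :: z1 :: z2 :: z3 :: h :: l) ->
    z \in h :: l ->
  next (z0 :: z1 :: z2 :: z3 :: h :: l) z =
  if next (h :: l) z == h then z0 else next (h :: l) z.
Proof.
move=> u zl.
have nz i : i \in [:: z0; z1; z2; z3] -> i \notin h :: l.
  move: u; rewrite (cat_uniq [:: z0; z1; z2; z3] (h :: l)) => /and3P [_ /hasPn H _] iz.
  by apply/negP => /H; rewrite iz.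
have zi i : i \in [:: z0; z1; z2; z3] -> z == i = false.
  by move=> /nz; apply: contraNF => /eqP <-.
have E : next (z0 :: z1 :: z2 :: z3 :: h :: l) z = next_at z z0 h l.
  by rewrite /= !zi // !inE eqxx ?orbT.
have N3 : next (z0 :: z1 :: z2 :: z3 :: h :: l) z3 = h.
  by apply: (next_consec (l := [:: z0; z1; z2]) u).
have -> : next (h :: l) z = if next_at z z0 h l == z0 then h else next_at z z0 h l.
  by apply: next_at_default => //; apply: nz; rewrite mem_head.
rewrite -E; case: (eqVneq (next _ z) z0) => [->|n0]; first by rewrite eqxx.
rewrite ifN // -{2}N3 (inj_eq (next_inj_in u)) zi // !inE eqxx ?orbT //.
Qed.

(* Two crossing cuts between four trivial letters: this creates an empty handle. *)
Lemma diagram_handle h l lam rho m : diagram (h :: l) lam rho m ->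
  exists z0 z1 z2 z3 lam' rho', [/\ diagram (z0 :: z1 :: z2 :: z3 :: h :: l) lam' rho' m,
    rho' z0 = z2, rho' z1 = z3,
    {in h :: l, lam' =1 lam} /\ {in [:: z0; z1; z2; z3], forall z, lam' z = ((lam h).1, e)} &
    moved rho' (z0 :: z1 :: z2 :: z3 :: h :: l) = 4 + moved rho (h :: l)].
Proof.
case=> u inv ty ds; have [b hb] := fresh_nat (h :: l).
pose z0 := b; pose z1 := b.+1; pose z2 := b.+2; pose z3 := b.+3.
have nb z : z \in h :: l -> [/\ z == z0 = false, z == z1 = false, z == z2 = false & z == z3 = false].
  by move=> /hb; rewrite /z0 /z1 /z2 /z3; split; lia.
have nl z : b <= z -> z \notin h :: l by move=> bz; apply/negP => /hb; lia.
pose lam' z := if z < b then lam z else ((lam h).1, e).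
pose rho' z := if z == z0 then z2 else if z == z2 then z0 else
               if z == z1 then z3 else if z == z3 then z1 else rho z.
have r0 : rho' z0 = z2 by rewrite /rho' eqxx.
have r2 : rho' z2 = z0 by rewrite /rho' /z0 /z1 /z2 /z3; do !case: eqP; lia.
have r1 : rho' z1 = z3 by rewrite /rho' /z0 /z1 /z2 /z3; do !case: eqP; lia.
have r3 : rho' z3 = z1 by rewrite /rho' /z0 /z1 /z2 /z3; do !case: eqP; lia.
have rl z : z \in h :: l -> rho' z = rho z.
  by move=> /nb [a0 a1 a2 a3]; rewrite /rho' a0 a1 a2 a3.
have lamb z : b <= z -> lam' z = ((lam h).1, e) by rewrite /lam' ltnNge => ->.
have laml z : z \in h :: l -> lam' z = lam z by move=> /hb zb; rewrite /lam' zb.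
have u' : uniq (z0 :: z1 :: z2 :: z3 :: h :: l).
  rewrite (cat_uniq [:: z0; z1; z2; z3] (h :: l)) u andbT; apply/andP; split.
    by rewrite /= !inE /z0 /z1 /z2 /z3; lia.
  by apply/hasPn => z /hb zb; rewrite /= !inE /z0 /z1 /z2 /z3; lia.
have hl : h \in h :: l by apply: mem_head.
pose L := [:: z0, z1, z2, z3, h & l]; have n0 : next L z0 = z1 by apply: (next_consec (l := [::]) u').
have n1 : next L z1 = z2 by apply: (next_consec (l := [:: z0]) u').
have n2 : next L z2 = z3 by apply: (next_consec (l := [:: z0; z1]) u').
have n3 : next L z3 = h by apply: (next_consec (l := [:: z0; z1; z2]) u').
have nL z : z \in h :: l -> next L z = if next (h :: l) z == h then z0 else next (h :: l) z.
  exact: next_prefix4.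
have case4 (P : nat -> Prop) : P z0 -> P z1 -> P z2 -> P z3 -> (forall z, z \in h :: l -> P z) ->
    {in L, forall z, P z}.
  move=> p0 p1 p2 p3 pl z; rewrite 4!in_cons.
  by case/orP => [/eqP -> //|/orP [/eqP -> //|/orP [/eqP -> //|/orP [/eqP -> //|/pl]]]].
have b0 : b <= z0 by rewrite /z0; lia.
have b1 : b <= z1 by rewrite /z1; lia.
have b2 : b <= z2 by rewrite /z2; lia.
have b3 : b <= z3 by rewrite /z3; lia.
exists z0, z1, z2, z3, lam', rho'; split=> //.
- split=> //.
  + have sub z : z \in h :: l -> z \in L by rewrite !inE => ->; rewrite !orbT.
    apply: case4; rewrite ?r0 ?r1 ?r2 ?r3 ?r0 ?r1 ?r2 ?r3 ?inE ?eqxx ?orbT //.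
    move=> z zl; have [rzl rr] := inv z zl; rewrite rl // rl //; split=> //.
    exact: sub.
  + apply: case4; rewrite ?r0 ?r1 ?r2 ?r3 ?n0 ?n1 ?n2 ?n3 ?(lamb z0) ?(lamb z1) ?(lamb z2) ?(lamb z3) ?laml //.
    move=> z zl; have [rzl _] := inv z zl; rewrite rl // nL // (laml z zl) -(ty z zl).
    by case: ifP => [/eqP ->|_]; [rewrite lamb|rewrite laml // mem_next].
  + have : disks (fun z => (lam' z).2) (next (h :: l) \o rho) (h :: l) m.
      by apply: disks_ext ds => // z zl; rewrite laml.
    (* The new walk passes [z0], [z3], [z2], [z1] and then reaches [h]: the handle creates no piece
       of its own, it only adds trivial letters to the piece of [h]. *)
    move/(@disks_ins _ _ _ _ (next L \o rho') _ [:: z3; z2; z1] z0 h).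
    case=> //.
    * by rewrite /= !inE /z0 /z1 /z2 /z3; lia.
    * move=> z; rewrite !inE => /or4P [] /eqP ->; rewrite lamb //; split=> //; exact: nl.
    * have pth s : s z0 = z3 -> s z3 = z2 -> s z2 = z1 -> s z1 = h ->
          fpath s z0 [:: z3; z2; z1; h] by move=> /= -> -> -> ->; rewrite !eqxx.
      by apply: pth; rewrite /comp ?r0 ?r1 ?r2 ?r3.
    * by move=> z zl; rewrite /comp; have [rzl _] := inv z zl; rewrite rl // nL.
    move=> Ds sz F; exists Ds => //; have [_ sub _] := F.
    apply: disk_family_ext F => // z /sub.
    by rewrite !inE => /or4P [->|->|->|/orP [->|->]]; rewrite ?orbT.
- by split=> // z; rewrite !inE => /or4P [] /eqP ->; rewrite lamb.
rewrite /moved /= r0 r1 r2 r3 /z0 /z1 /z2 /z3.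
have -> : count (fun z => rho' z != z) l = count (fun z => rho z != z) l.
  by apply: eq_in_count => z zl; rewrite rl // inE zl orbT.
by rewrite rl //; lia.
Qed.

Lemma next_ins l1 (p c : nat) l2 : uniq (l1 ++ p :: c :: l2) ->
  next (l1 ++ p :: c :: l2) c = next (l1 ++ p :: l2) p /\
  {in l1 ++ p :: l2, forall z, next (l1 ++ p :: c :: l2) z =
    if z == p then c else next (l1 ++ p :: l2) z}.
Proof.
move=> u; have np := next_consec u.
have := @next_del _ (rcons l1 p) l2 c; rewrite !cat_rcons => nd.
have pl : p \in l1 ++ p :: l2 by rewrite mem_cat mem_head orbT.
split; first by rewrite nd // np eqxx.
move=> z zl; case: eqVneq => [->//|zp]; rewrite nd // -[c in _ == c]np.
by rewrite (inj_eq (next_inj_in u)) (negbTE zp).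
Qed.

(** The cut is doubled, and the strip between the two parallel copies is a disk with sides [c] and
    [c']. One more cut and one more disk leave the Euler characteristic unchanged. *)
Lemma diagram_mirror1 l1 p l2 q l3 lam rho m t (a : G) :
    let l := l1 ++ p :: l2 ++ q :: l3 in diagram l lam rho m -> rho p = q ->
  exists c c' lam' rho', [/\ diagram (l1 ++ p :: c' :: l2 ++ q :: c :: l3) lam' rho' m.+1,
    lam' c = (t, a) /\ lam' c' = (t, a^-), {in l, lam' =1 lam},
    rho' p = c /\ {in l, forall z, z != p -> z != q -> rho' z = rho z} &
    moved rho' (l1 ++ p :: c' :: l2 ++ q :: c :: l3) = moved rho l + 2].
Proof.
move=> l [u inv ty ds] rp; have [b hb] := fresh_nat l.
have pl : p \in l by rewrite /l mem_cat mem_head orbT.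
have ql : q \in l by rewrite -rp; case: (inv p pl).
have rq : rho q = p by rewrite -rp; case: (inv p pl).
have pq : p != q.
  move: u; rewrite /l cat_uniq /= => /and3P [_ _ /andP [+ _]].
  by apply: contraNneq => ->; rewrite mem_cat mem_head orbT.
pose c := b; pose c' := b.+1; pose L := l1 ++ p :: c' :: l2 ++ q :: c :: l3.
have cl : c \notin l by apply/negP => /hb; rewrite /c; lia.
have c'l : c' \notin l by apply/negP => /hb; rewrite /c'; lia.
have cc' : c != c' by rewrite /c /c'; lia.
have pm : perm_eq L ([:: c; c'] ++ l).
  by apply/permP => P; rewrite /L /l /= !count_cat /= !count_cat /=; lia.
have memL z : z \in L = [|| z == c, z == c' | z \in l] by rewrite (perm_mem pm) mem_cat !inE orbA.
have uL : uniq L.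
  by rewrite (perm_uniq pm) /= u inE negb_or cc' cl c'l.
pose L1 := (l1 ++ p :: l2) ++ q :: c :: l3.
have uL1 : uniq L1.
  by have := @uniq_del (rcons l1 p) c' (l2 ++ q :: c :: l3); rewrite !cat_rcons /L1 -catA; apply.
have lE : l = (l1 ++ p :: l2) ++ q :: l3 by rewrite /l -catA.
have [nc nL1] := next_ins uL1; rewrite -lE -/L1 in nc nL1.
have L1E : L1 = l1 ++ p :: l2 ++ q :: c :: l3 by rewrite /L1 -catA.
have [nc' nL] := next_ins uL; rewrite -/L -L1E in nc' nL.
have sub1 z : z \in l -> z \in L1.
  by rewrite /L1 lE !mem_cat !inE => /or3P [->|->|->]; rewrite ?orbT.
have c1 : c \in L1 by rewrite /L1 mem_cat !inE eqxx !orbT.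
have np : next L p = c' by rewrite nL ?sub1 // eqxx.
have nq : next L q = c by rewrite nL ?sub1 // eq_sym (negbTE pq) nL1 // eqxx.
have ncE : next L c = next l q.
  by rewrite nL // ifN ?nc //; apply: contraNneq cl => ->.
have nc'E : next L c' = next l p by rewrite nc' nL1 // (negbTE pq).
have nz z : z \in l -> z != p -> z != q -> next L z = next l z.
  by move=> zl zp zq; rewrite nL ?sub1 // (negbTE zp) nL1 // (negbTE zq).
pose lam' z := if z == c then (t, a) else if z == c' then (t, a^-) else lam z.
pose rho' z := if z == p then c else if z == c then p else if z == q then c' else
  if z == c' then q else rho z.
have lc : lam' c = (t, a) by rewrite /lam' eqxx.
have lc' : lam' c' = (t, a^-) by rewrite /lam' eq_sym (negbTE cc') eqxx.
have lz z : z \in l -> lam' z = lam z.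
  move=> zl; rewrite /lam' !ifN //; first by apply: contraNneq c'l => <-.
  by apply: contraNneq cl => <-.
have cp : c != p by apply: contraNneq cl => ->.
have c'p : c' != p by apply: contraNneq c'l => ->.
have cq : c != q by apply: contraNneq cl => ->.
have c'q : c' != q by apply: contraNneq c'l => ->.
have r'p : rho' p = c by rewrite /rho' eqxx.
have r'c : rho' c = p by rewrite /rho' (negbTE cp) eqxx.
have r'q : rho' q = c' by rewrite /rho' eq_sym (negbTE pq) eq_sym (negbTE cq) eqxx.
have r'c' : rho' c' = q.
  by rewrite /rho' (negbTE c'p) eq_sym (negbTE cc') (negbTE c'q) eqxx.
have r'z z : z \in l -> z != p -> z != q -> rho' z = rho z.
  move=> zl /negbTE zp /negbTE zq; rewrite /rho' zp zq !ifN //.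
    by apply: contraNneq c'l => <-.
  by apply: contraNneq cl => <-.
have rz z : z \in l -> z != p -> z != q -> [/\ rho z \in l, rho z != p & rho z != q].
  move=> zl zp zq; have [rl rr] := inv z zl; split=> //.
    by apply: contraNneq zq => h; rewrite -rr h rp.
  by apply: contraNneq zp => h; rewrite -rr h rq.
have same z : z \in l -> next L (rho' z) = next l (rho z).
  move=> zl; case: (eqVneq z p) => [->|zp]; first by rewrite r'p ncE rp.
  case: (eqVneq z q) => [->|zq]; first by rewrite r'q nc'E rq.
  by have [h1 h2 h3] := rz z zl zp zq; rewrite r'z // nz.
exists c, c', lam', rho'; split=> //; last first.
  rewrite /moved (permP pm) count_cat /= r'c r'c' [p == c]eq_sym cp [q == c']eq_sym c'q /=.
  have -> : count (fun z => rho' z != z) l = count (fun z => rho z != z) l; last by lia.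
  apply: eq_in_count => z zl; case: (eqVneq z p) => [->|zp]; first by rewrite r'p rp cp eq_sym pq.
  case: (eqVneq z q) => [->|zq]; first by rewrite r'q rq c'q pq.
  by rewrite r'z.
rewrite -/L; split=> //.
- move=> z; rewrite !memL => /or3P [/eqP ->|/eqP ->|zl].
  + by rewrite r'c r'p pl !orbT.
  + by rewrite r'c' r'q ql !orbT.
  + case: (eqVneq z p) => [->|zp]; first by rewrite r'p r'c eqxx.
    case: (eqVneq z q) => [->|zq]; first by rewrite r'q r'c' eqxx orbT.
    by have [h1 h2 h3] := rz z zl zp zq; rewrite r'z // h1 !orbT r'z //; case: (inv z zl).
- move=> z; rewrite memL => /or3P [/eqP ->|/eqP ->|zl].
  + by rewrite r'c np lc lc'.
  + by rewrite r'c' nq lc lc'.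
  + rewrite same // !lz ?ty //; rewrite mem_next; by case: (inv z zl).
have dl : disks (fun z => (lam' z).2) (next L \o rho') l m.
  by apply: disks_ext ds => // z zl; rewrite /comp ?lz ?same.
have : disks (fun z => (lam' z).2) (next L \o rho') ([:: c; c'] ++ l) m.+1.
  apply: disks_cons dl.
  - split=> //; last by rewrite /= lc lc' /= gmul1r gmulVr.
    have cyc2 s : s c = c' -> s c' = c -> fcycle s [:: c; c'] by move=> /= -> ->; rewrite !eqxx.
    by apply: cyc2; rewrite /comp ?r'c ?r'c'.
  - by rewrite /= inE cc'.
  - by move=> z; rewrite !inE => /orP [] /eqP ->.
by apply: disks_ext => // z; rewrite (perm_mem pm).
Qed.

Definition winv x := rev (map (fun c => (c.1, c.2^-)) x).

(** Each further letter doubles the cut that joins [p] to the letter inserted last. New letters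
    therefore come directly behind [p] on one side and at the end of the inserted block on the
    other, which gives the reversal in [winv]. *)
Lemma diagram_mirror x l1 p l2 q l3 lam rho m :
    let l := l1 ++ p :: l2 ++ q :: l3 in diagram l lam rho m -> rho p = q ->
  exists c c' lam' rho' m', [/\ diagram (l1 ++ p :: c' ++ l2 ++ q :: c ++ l3) lam' rho' m',
    map lam' c = x /\ map lam' c' = winv x, {in l, lam' =1 lam},
    {in l, forall z, z != p -> z != q -> rho' z = rho z} &
    moved rho' (l1 ++ p :: c' ++ l2 ++ q :: c ++ l3) + 2 * m = moved rho l + 2 * m'].
Proof.
elim: x l2 q l3 lam rho m => [|[t a] x IH] l2 q l3 lam rho m l Dg rp.
  by exists [::], [::], lam, rho, m; split.
have [d [d' [lam1 [rho1 [Dg1 [ld ld'] l1E [r1p r1z] mv1]]]]] := diagram_mirror1 t a Dg rp.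
have lE : l1 ++ p :: d' :: l2 ++ q :: d :: l3 = l1 ++ p :: (d' :: rcons l2 q) ++ d :: l3.
  by rewrite /= cat_rcons.
rewrite lE in Dg1 mv1.
have [c [c' [lam' [rho' [m' [Dg' [lc lc'] lE' rz mv]]]]]] := IH _ _ _ _ _ _ Dg1 r1p.
set l' := l1 ++ p :: (d' :: _) ++ _ in lE' Dg1 mv1 rz mv.
have u1 : uniq l' by case: Dg1.
have sub z : z \in l -> z \in l'.
  rewrite /l /l' /= !(mem_cat, inE, mem_rcons).
  by case/or4P => [->|->|->|/orP [->|->]]; rewrite ?orbT.
have dl : d \notin l.
  apply/negP => dl; move: u1; rewrite /l' uniq_catC -!cat_cons -catA uniq_catC /=.
  rewrite -catA /= => /andP [/negP + _]; apply.
  by move: dl; rewrite /l !(mem_cat, inE, mem_rcons); case/or4P => [->|->|->|/orP [/eqP ->|->]]; rewrite ?eqxx ?orbT.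
exists (d :: c), (rcons c' d'), lam', rho', m'.
have LE : l1 ++ p :: rcons c' d' ++ l2 ++ q :: (d :: c) ++ l3 =
          l1 ++ p :: c' ++ (d' :: rcons l2 q) ++ d :: c ++ l3.
  by rewrite /= !cat_rcons.
rewrite LE; split=> //.
- have dm : d \in l' by rewrite /l' !(mem_cat, inE) eqxx !orbT.
  have dm' : d' \in l' by rewrite /l' !(mem_cat, inE) eqxx !orbT.
  by rewrite /winv /= rev_cons map_rcons lc lc' !lE' // ld ld'.
- by move=> z zl; rewrite lE' ?sub // l1E.
- move=> z zl zp zq; rewrite rz ?sub //; first exact: r1z.
  by apply: contraNneq dl => <-.
- by move: mv mv1; rewrite -/l; lia.
Qed.

(* [moved] counts the ends of cuts, so the inequality says that the Euler characteristic
   (disks minus cuts) is at least that of a genus [k] surface with one boundary curve. *)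
Definition drawable w k := exists l lam rho m,
  [/\ diagram l lam rho m, map lam l = w & moved rho l + 2 <= 2 * m + 4 * k].

Lemma drawable1 t : drawable [:: (t, e)] 0.
Proof.
exists [:: 0], (fun=> (t, e)), id, 1; split=> //; split=> //.
exists [:: [:: 0]] => //; split=> //= d; rewrite inE => /eqP ->; split=> //=.
by rewrite gmul1l.
Qed.

(** The crossing cuts of an empty handle, doubled along [x] and [y], spell a commutator. The handle
    adds four ends of cuts and no disk, which is exactly what one more genus allows. *)
Lemma drawable_handle x y c w k : drawable (c :: w) k ->
  drawable ((c.1, e) :: winv x ++ (c.1, e) :: winv y ++ (c.1, e) :: x ++ (c.1, e) :: y ++ c :: w) k.+1.
Proof.
case=> [[|h l] [lam [rho [m [Dg //= [lh lw] mv]]]]].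
have [z0 [z1 [z2 [z3 [lam1 [rho1 [Dg1 r02 r13 [le1 lz1] mv1]]]]]]] := diagram_handle Dg.
have u : uniq [:: z0, z1, z2, z3, h & l] by case: Dg1.
have [x1 [x1' [lam2 [rho2 [m2 [Dg2 [lx lx'] le2 rz2 mv2]]]]]] :=
  diagram_mirror (l1 := [::]) x (l2 := [:: z1]) (l3 := z3 :: h :: l) Dg1 r02.
rewrite /= in Dg2 mv2 le2 rz2.
have lE2 : z0 :: x1' ++ [:: z1, z2 & x1 ++ [:: z3, h & l]] =
  (z0 :: x1') ++ z1 :: (z2 :: x1) ++ z3 :: h :: l by [].
have r13' : rho2 z1 = z3.
  move: u; rewrite /= !inE !negb_or => /and5P [/and3P [z01 _ _] /andP [z12 _] _ _ _].
  by rewrite rz2 // ?inE ?eqxx ?orbT // eq_sym.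
rewrite lE2 in Dg2 mv2.
have [y1 [y1' [lam3 [rho3 [m3 [Dg3 [ly ly'] le3 rz3 mv3]]]]]] := diagram_mirror y Dg2 r13'.
exists ((z0 :: x1') ++ z1 :: y1' ++ (z2 :: x1) ++ z3 :: y1 ++ h :: l), lam3, rho3, m3.
split=> //; last by move: mv mv1 mv2 mv3; lia.
have in2 z : z \in [:: z0, z1, z2, z3, h & l] -> lam2 z = lam1 z by apply: le2.
have e3 z : z \in [:: z0, z1, z2, z3, h & l] -> lam3 z = lam1 z.
  move=> zl; rewrite le3 ?in2 //; move: zl; rewrite !(inE, mem_cat).
  by case/or4P => [->|->|->|/or3P [->|->|->]]; rewrite ?orbT.
have e3l z : z \in h :: l -> lam3 z = lam z.
  by move=> zl; rewrite e3 ?le1 //; move: zl; rewrite !inE => ->; rewrite !orbT.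
have e3z z : z \in [:: z0; z1; z2; z3] -> lam3 z = (c.1, e).
  move=> zl; rewrite e3 ?lz1 // ?lh //.
  by move: zl; rewrite !inE => /or4P [] ->; rewrite ?orbT.
have e3x : map lam3 x1 = x.
  rewrite -lx; apply/eq_in_map => z zl; apply: le3.
  by rewrite !(inE, mem_cat) zl !orbT.
have e3x' : map lam3 x1' = winv x.
  rewrite -lx'; apply/eq_in_map => z zl; apply: le3.
  by rewrite !(inE, mem_cat) zl !orbT.
rewrite /= !(map_cat, map_cons) e3x e3x' ly ly' (e3z z0) ?(e3z z1) ?(e3z z2) ?(e3z z3) ?inE ?eqxx ?orbT //=.
have -> : map lam3 l = w.
  by rewrite -lw; apply/eq_in_map => z zl; rewrite e3l // inE zl orbT.
by rewrite e3l ?mem_head // lh.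
Qed.

Lemma drawable_merge w1 t (a b : G) w2 k :
  drawable (w1 ++ (t, a) :: (t, b) :: w2) k -> drawable (w1 ++ (t, a ** b) :: w2) k.
Proof.
case=> l [lam [rho [m [Dg lw mv]]]].
have [l1 [l2 [lE l1w l2w]]] : exists l1 l2,
    [/\ l = l1 ++ l2, map lam l1 = w1 & map lam l2 = (t, a) :: (t, b) :: w2].
  exists (take (size w1) l), (drop (size w1) l).
  by rewrite cat_take_drop map_take map_drop lw take_size_cat // drop_size_cat.
case: l2 l2w lE => [//|x [//|y l2]] /= [lx ly l2w] lE; subst l.
have u : uniq (l1 ++ x :: y :: l2) by case: Dg.
have nx := next_consec u.
have xl : x \in l1 ++ x :: y :: l2 by rewrite mem_cat mem_head orbT.
have [|rho1 [m1 [Dg1 rx mv1]]] := diagram_uncut Dg xl; first by rewrite nx lx ly.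
have ne : l1 ++ y :: l2 != [::] by case: (l1).
have [Dg2 mv2] := diagram_del_fix Dg1 rx ne.
move: Dg2; rewrite /= nx => Dg2.
eexists _, _, rho1, m1; split; first exact: Dg2; last by move: mv1 mv mv2; lia.
have [u2 _ _ _] := Dg2; move: u2; rewrite uniq_catC /= mem_cat negb_or => /andP [/andP [y2 y1] _].
rewrite map_cat /= eqxx lx ly /=; congr (_ ++ _ :: _).
  by rewrite -l1w; apply/eq_in_map => z zl; rewrite ifN //; apply: contraNneq y1 => <-.
by rewrite -l2w; apply/eq_in_map => z zl; rewrite ifN //; apply: contraNneq y2 => <-.
Qed.

Lemma drawable_del w1 t w2 k : w1 ++ w2 <> [::] ->
  drawable (w1 ++ (t, e) :: w2) k -> drawable (w1 ++ w2) k.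
Proof.
move=> ne [l [lam [rho [m [Dg lw mv]]]]].
have [l1 [l2 [lE l1w l2w]]] : exists l1 l2,
    [/\ l = l1 ++ l2, map lam l1 = w1 & map lam l2 = (t, e) :: w2].
  exists (take (size w1) l), (drop (size w1) l).
  by rewrite cat_take_drop map_take map_drop lw take_size_cat // drop_size_cat.
case: l2 l2w lE => [//|r l2] /= [lr l2w] lE; subst l.
have [||rho1 [m1 [Dg1 mv1]]] := diagram_del_triv Dg; first by rewrite lr.
  apply/eqP => nil; apply: ne; rewrite -l1w -l2w.
  by rewrite -map_cat nil.
exists (l1 ++ l2), lam, rho1, m1; split=> //; last by move: mv mv1; lia.
by rewrite map_cat l1w l2w.
Qed.
End Drawings.

(** * Counting disks in a periodic diagram *)

Section CountLemmas.
Variable T : eqType.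
Implicit Types (l d : seq T) (P Q : pred T).

Lemma count_subset P l1 l2 : uniq l1 -> {subset l1 <= l2} -> count P l1 <= count P l2.
Proof.
move=> u sub; rewrite -!size_filter; apply: uniq_leq_size; first exact: filter_uniq.
by move=> z; rewrite !mem_filter => /andP [-> /sub].
Qed.

Lemma count_inv P (f : T -> T) l : uniq l -> {in l, forall z, f z \in l} -> {in l &, injective f} ->
  count (P \o f) l = count P l.
Proof.
move=> u fl inj; rewrite -count_map.
have um : uniq (map f l) by rewrite map_inj_in_uniq.
have sub : {subset map f l <= l} by move=> z /mapP [y yl ->]; apply: fl.
have [_ eqm] := uniq_min_size um sub (eq_leq (esym (size_map f l))).
by apply/permP/uniq_perm => //.
Qed.

Lemma count_flatten P (ss : seq (seq T)) : count P (flatten ss) = \sum_(d <- ss) count P d.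
Proof. by elim: ss => [|d ss IH] /=; rewrite ?big_nil // big_cons count_cat IH. Qed.

Lemma sum_lt_seq (f g : T -> nat) d : {in d, forall z, f z <= g z} -> has (fun z => f z < g z) d ->
  \sum_(z <- d) f z < \sum_(z <- d) g z.
Proof.
elim: d => //= x d IH h; rewrite !big_cons.
have hx : f x <= g x by apply: h; rewrite mem_head.
have hd : \sum_(z <- d) f z <= \sum_(z <- d) g z.
  rewrite big_seq [X in _ <= X]big_seq; apply: leq_sum => z zd; apply: h.
  by rewrite inE zd orbT.
case/orP => [lt|lt]; first by lia.
have := IH (fun z zd => h z (mem_behead (s := x :: d) zd)) lt; lia.
Qed.

Lemma perm_map_fcycle (f : T -> T) d : fcycle f d -> perm_eq (map f d) d.
Proof.
case: d => // x d; rewrite /cycle => p.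
have -> : map f (x :: d) = rcons d x.
  elim: d {1 3}x p => [|y d IH] z /=; first by rewrite andbT => /eqP ->.
  by case/andP => /eqP -> /IH /= ->.
by rewrite perm_rcons.
Qed.

Lemma index_next l z : uniq l -> z \in l -> index (next l z) l = (index z l).+1 %% size l.
Proof.
move=> u zl; rewrite next_nth zl; have := zl; rewrite -index_mem.
case: l u zl => // y p u zl; set i := index z _; rewrite [size _]/= ltnS leq_eqVlt.
case/orP => [/eqP ->|ip]; first by rewrite nth_default // modnn /= eqxx.
by rewrite modn_small // -[nth y p i]/(nth y (y :: p) i.+1) index_uniq.
Qed.
End CountLemmas.

Lemma count_iota_mod t c a n : c < t ->
  count (fun i => (i + a) %% t == c) (iota 0 (n * t)) = n.
Proof.
move=> ct; elim: n => [|n IH]; first by rewrite mul0n.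
rewrite mulSn addnC iotaD count_cat IH add0n addnC -[RHS]add1n; congr (_ + _).
rewrite -[n * t]addn0 iotaDl count_map.
rewrite -(@eq_count _ (pred1 c \o (fun i => (i + a) %% t))); last first.
  by move=> i /=; rewrite -addnA modnMDl.
rewrite -count_map count_uniq_mem.
  have -> // : c \in [seq (i + a) %% t | i <- iota 0 t].
  apply/mapP; exists ((c + (t - a %% t)) %% t).
    by rewrite mem_iota add0n ltn_mod (leq_ltn_trans _ ct).
  rewrite modnDml -modnDmr -addnA subnK; first by rewrite modnDr modn_small.
  by apply: ltnW; rewrite ltn_mod (leq_ltn_trans _ ct).
rewrite map_inj_in_uniq ?iota_uniq // => i j; rewrite !mem_iota !add0n => it jt /eqP.
by rewrite eqn_modDr !modn_small // => /eqP.
Qed.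

Lemma nth_flatten_nseq (X : Type) (x0 : X) w n i : i < n * size w ->
  nth x0 (flatten (nseq n w)) i = nth x0 w (i %% size w).
Proof.
elim: n i => [|n IH] i; first by rewrite mul0n.
rewrite mulSn /= nth_cat; case: (ltnP i (size w)) => [lt _|ge lt]; first by rewrite modn_small.
by rewrite IH ?ltn_subLR // -{2}(subnK ge) modnDr.
Qed.

Lemma size_flatten_nseq (X : Type) (w : seq X) n : size (flatten (nseq n w)) = n * size w.
Proof. by elim: n => //= n IH; rewrite size_cat IH mulSn. Qed.

Section PeriodicDiagram.
Variables (G : Group) (W : seq (bool * G)) (n h N : nat).
Variables (l : seq nat) (lam : nat -> bool * G) (rho : nat -> nat) (m : nat).
Local Notation e := (gone G).
Local Notation T := (size W).
Hypothesis h_gt0 : 0 < h.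
Hypothesis TE : T = h.*2.
Hypothesis W_typ : forall i, i < T -> (nth (true, e) W i).1 = ~~ odd i.
Hypothesis W_ne1 : forall i, i < T -> (nth (true, e) W i).2 <> e.
Hypothesis N_le : forall (x : G) j, x <> e -> 0 < j -> gpow G x j = e -> N <= j.
Hypothesis Dg : diagram l lam rho m.
Hypothesis lamE : map lam l = flatten (nseq n W).
Variable sh : nat.

(** The shift matters because ascents depend on where the cyclic order of positions is cut open, and
    the last count needs a free choice of this place. *)
Definition residue (z : nat) := (index z l + sh) %% T.
Local Notation r := residue.
Local Notation sigma := (next l \o rho).

Let T_gt0 : 0 < T. Proof. by rewrite TE; lia. Qed.
Let size_l : size l = n * T.
Proof. by rewrite -(size_map lam) lamE size_flatten_nseq. Qed.
Let u : uniq l. Proof. by case: Dg. Qed.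
Let rho_in z : z \in l -> rho z \in l. Proof. by case: Dg => _ H _ _ /H []. Qed.
Let rhoK z : z \in l -> rho (rho z) = z. Proof. by case: Dg => _ H _ _ /H []. Qed.
Let sig_in z : z \in l -> sigma z \in l. Proof. by move=> zl; rewrite /= mem_next rho_in. Qed.

Lemma lam_nth z : z \in l -> lam z = nth (true, e) W (index z l %% T).
Proof.
move=> zl; have il : index z l < size l by rewrite index_mem.
rewrite -(@nth_flatten_nseq _ _ _ n) -?size_l // -lamE (nth_map 0) //.
by rewrite nth_index.
Qed.

Lemma residue_lt z : r z < T. Proof. by rewrite ltn_mod. Qed.

Lemma residue_next z : z \in l -> r (next l z) = if r z == T.-1 then 0 else (r z).+1.
Proof.
move=> zl; rewrite /r index_next // size_l.
rewrite -modnDml modn_dvdm ?dvdn_mull // modnDml addSn -addn1 -modnDml.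
have := residue_lt z; rewrite /r; case: eqVneq => [->|ne lt].
  by rewrite addn1 prednK // modnn.
by rewrite addn1 modn_small //; lia.
Qed.

Lemma typ_parity z : z \in l -> (lam z).1 = ~~ odd (index z l).
Proof.
move=> zl; rewrite lam_nth // W_typ ?ltn_mod //.
by rewrite odd_mod // TE odd_double.
Qed.

(** Types alternate and [W] has even length, so type is parity of the position. The letter behind
    [rho z] has the type of [z], hence [rho z] has the other one. *)
Lemma residue_rho z : z \in l -> r (rho z) != r z.
Proof.
move=> zl; apply/negP => /eqP E.
have : odd (r (rho z)) = odd (r z) by rewrite E.
rewrite /r !odd_mod ?TE ?odd_double // !oddD => /addIb.
have : (lam (next l (rho z))).1 = (lam z).1 by case: Dg => _ _ H _; apply: H.
rewrite !typ_parity //; last exact: sig_in.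
rewrite index_next ?rho_in // size_l odd_mod; last by rewrite TE oddM odd_double andbF.
rewrite /= negbK => -> ; by case: odd.
Qed.

(* By [ascE] this says that [sigma] raises the residue at [z]; in this form exactly one of [z] and
   [rho z] is ascending unless one of them has the maximal residue. *)
Definition asc z := (r z < r (rho z)) && (r (rho z) < T.-1).

Lemma ascE z : z \in l -> (r z < r (sigma z)) = asc z.
Proof.
move=> zl; rewrite /= residue_next ?rho_in // /asc.
have := residue_rho zl; have := residue_lt (rho z).
by case: (eqVneq (r (rho z)) T.-1) => [->|]; lia.
Qed.

Lemma moved_all : moved rho l = n * T.
Proof.
rewrite -size_l; apply/eqP; rewrite -all_count; apply/allP => z zl.
by apply: contraNneq (residue_rho zl) => ->.
Qed.

Lemma count_residue c : c < T -> count (fun z => r z == c) l = n.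
Proof.
move=> ct; rewrite -[RHS](@count_iota_mod T c sh n) // -size_l.
have -> : iota 0 (size l) = map (index^~ l) l.
  apply: (@eq_from_nth _ 0); rewrite ?size_map ?size_iota // => i il.
  by rewrite nth_iota // (nth_map 0) // add0n index_uniq.
by rewrite count_map.
Qed.

(** Counted cut by cut: the two ends have different residues, so either exactly one end is maximal
    and none ascends, or none is maximal and exactly one ascends. *)
Lemma count_asc (Q : pred nat) : {in l, forall z, Q (rho z) = Q z} ->
  2 * count (fun z => asc z && Q z) l + 2 * count (fun z => (r z == T.-1) && Q z) l = count Q l.
Proof.
move=> Qs.
have inj : {in l &, injective rho} by move=> y z yl zl E; rewrite -(rhoK yl) E rhoK.
have cs (P : pred nat) : 2 * count P l = \sum_(z <- l) (P z + P (rho z)).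
  rewrite big_split /= -!sum1_count -!big_mkcond /= !sum1_count mul2n -addnn; congr (_ + _).
  by rewrite -[LHS](count_inv P u rho_in inj).
rewrite !cs -big_split -sum1_count [RHS]big_mkcond /= big_seq [RHS]big_seq.
apply: eq_bigr => z zl; rewrite Qs // /asc rhoK //.
have := residue_rho zl; have := residue_lt (rho z); have := residue_lt z.
by case: (Q z); rewrite ?andbT ?andbF //; lia.
Qed.

Lemma asc_total : count asc l = n * h - n.
Proof.
have H : 2 * count asc l + 2 * count (fun z => r z == T.-1) l = size l.
  rewrite -(count_predT l) -(@count_asc xpredT) //.
  by congr (2 * _ + 2 * _); apply: eq_count => z /=; rewrite andbT.
rewrite count_residue ?prednK // size_l TE in H.
by nia.
Qed.

(* Equivalently [r z + r (sigma z) = 0] modulo [T]: the reflection fixing the residues 0 and [h]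
   exchanges the two letters that such a step joins. *)
Definition central z := r z + r (rho z) == T.-1.

(** Cuts without a maximal end have one ascending end and one other. The surplus comes from the [n]
    letters of residue [T.-1], less those on central cuts, and [rho] pairs the latter with the
    central corners of residue 0. *)
Lemma noncentral_total :
  count (fun z => ~~ asc z && ~~ central z) l + 2 * count (fun z => (r z == 0) && central z) l
    = count (fun z => asc z && ~~ central z) l + 2 * n.
Proof.
have sym : {in l, forall z, central (rho z) = central z}.
  by move=> z zl; rewrite /central rhoK // addnC.
have H := @count_asc (fun z => ~~ central z) (fun z zl => congr1 negb (sym z zl)).
have inj : {in l &, injective rho} by move=> y z yl zl E; rewrite -(rhoK yl) E rhoK.
have E1 : count (fun z => (r z == 0) && central z) l = count (fun z => (r z == T.-1) && central z) l.
  rewrite -[RHS](count_inv _ u rho_in inj); apply: eq_in_count => z zl /=.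
  by rewrite sym //; rewrite /central; have := residue_lt z; lia.
have E2 := count_predC (fun z => central z) [seq z <- l | r z == T.-1].
rewrite !count_filter size_filter count_residue ?prednK // in E2.
have E3 := count_predC (fun z => asc z) [seq z <- l | ~~ central z].
rewrite !count_filter size_filter in E3.
rewrite E1.
have E4 : count (fun z => (r z == T.-1) && central z) l = count (predI (fun z => central z) (fun z => r z == T.-1)) l.
  by apply: eq_count => z /=; rewrite andbC.
have E5 : count (fun z => (r z == T.-1) && ~~ central z) l = count (predI (predC (fun z => central z)) (fun z => r z == T.-1)) l.
  by apply: eq_count => z /=; rewrite andbC.
rewrite -E4 -E5 in E2.
have E6 : count (predI (fun z => asc z) (fun z => ~~ central z)) l = count (fun z => asc z && ~~ central z) l by [].
have E7 : count (predI (predC (fun z => asc z)) (fun z => ~~ central z)) l = count (fun z => ~~ asc z && ~~ central z) l by [].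
rewrite E6 E7 in E3.
by lia.
Qed.

Lemma asc_residue z : asc z -> z \in l -> r (sigma z) = (r (rho z)).+1.
Proof. by move=> /andP [_ lt] zl; rewrite /= residue_next ?rho_in // ifN //; lia. Qed.

Lemma central_residue z : central z -> z \in l -> 0 < r z -> r z + r (sigma z) = T.
Proof.
move=> /eqP c zl rz; rewrite /= residue_next ?rho_in //.
by have := residue_lt z; case: eqVneq; lia.
Qed.

Lemma central_path y p z : y \in l -> {subset p <= l} -> fpath sigma y (rcons p z) ->
  {in y :: p, forall t, central t} -> 0 < r y -> r y + r y = T -> r z = r y.
Proof.
elim: p y => [|y' p IH] y yl pl.
  rewrite [fpath _ _ _]/= andbT => /eqP sy c ry E.
  have := central_residue (c y (mem_head _ _)) yl ry; rewrite -[sigma y]/(next l (rho y)) sy; lia.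
rewrite [fpath _ _ _]/= => /andP [/eqP sy pp] c ry E.
have E2 := central_residue (c y (mem_head _ _)) yl ry.
rewrite -[sigma y]/(next l (rho y)) sy in E2.
have Ey : r y' = r y by lia.
rewrite (IH y') ?Ey //; first exact/pl/mem_head.
- by move=> t tp; apply: pl; rewrite inE tp orbT.
- by move=> t tp; apply: c; rewrite inE tp orbT.
Qed.

Definition tied d := all (fun z => r (sigma z) == r z) d.

(** The residues have the same sum before and after a step around the cycle. So they can neither all
    weakly drop, one of them strictly, nor all rise. *)
Lemma not_tied_asc d : fcycle sigma d -> {subset d <= l} -> ~~ tied d ->
  0 < count asc d /\ 0 < count (fun z => ~~ asc z) d.
Proof.
move=> cd dl nt.
have E : \sum_(z <- d) r (sigma z) = \sum_(z <- d) r z.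
  by rewrite -[LHS](big_map sigma xpredT r); apply: perm_big; apply: perm_map_fcycle.
split.
  rewrite -has_count; apply: contraT => /hasPn na.
  suff : \sum_(z <- d) r (sigma z) < \sum_(z <- d) r z by rewrite E ltnn.
  apply: sum_lt_seq => [z zd|]; first by rewrite leqNgt ascE ?dl // na.
  have /allPn [z zd nz] := nt; apply/hasP; exists z => //.
  by rewrite ltn_neqAle nz leqNgt ascE ?dl // na.
rewrite -has_count; apply: contraT => /hasPn na.
suff : \sum_(z <- d) r z < \sum_(z <- d) r (sigma z) by rewrite E ltnn.
have lt z : z \in d -> r z < r (sigma z).
  by move=> zd; rewrite ascE ?dl //; have := na z zd; rewrite negbK.
apply: sum_lt_seq => [z /lt /ltnW //|].
by have /allPn [z zd _] := nt; apply/hasP; exists z => //; apply: lt.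
Qed.

(* With a single ascent, the non-ascending steps cannot all be central: two consecutive central
   steps return to the same residue. *)
Lemma central_balance d : fcycle sigma d -> uniq d -> {subset d <= l} -> ~~ tied d ->
  count (fun z => asc z && ~~ central z) d + 2 <=
  count (fun z => ~~ asc z && ~~ central z) d + 2 * count asc d.
Proof.
move=> cd ud dl nt; have [a1 _] := not_tied_asc cd dl nt.
have sub : count (fun z => asc z && ~~ central z) d <= count asc d.
  by apply: sub_count => z /andP [].
have [|lt] := leqP 2 (count asc d); first by lia.
have a2 : count asc d = 1 by lia.
have [z zd az] : exists2 z : nat, z \in d & asc z by apply/hasP; rewrite has_count.
have [i [d' dE]] : exists i (d' : seq nat), rot i d = z :: d'.
  by case: (rot_to zd) => i d'; exists i, d'.
have pm : perm_eq d (z :: d') by rewrite -dE perm_sym perm_rot.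
have cd' : fcycle sigma (z :: d') by rewrite -dE rot_cycle.
have dl' : {subset z :: d' <= l} by move=> t; rewrite -(perm_mem pm); apply: dl.
rewrite !(permP pm) /= az /= in a2 *.
have a3 : count asc d' = 0 by case: a2.
have na : {in d', forall t, ~~ asc t} by apply/hasPn; rewrite has_count a3.
have c0 : count (fun t => asc t && ~~ central t) d' = 0.
  by apply/eqP; rewrite -leqn0 leqNgt -has_count; apply/hasPn => t /na /negbTE ->.
rewrite a3 c0 addn0.
have [cz|ncz] := boolP (central z); first exact: leq_addl.
suff c1 : 0 < count (fun t => ~~ asc t && ~~ central t) d'.
  by rewrite add0n leq_add2r.
rewrite -has_count; apply: contraT => /hasPn nc.
have cen : {in d', forall t, central t}.
  by move=> t td; have := nc t td; rewrite na // negbK.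
have zl : z \in l by apply: dl'; rewrite mem_head.
have lt' : r z < r (sigma z) by rewrite ascE.
have sz := asc_residue az zl.
case: d' {dE pm a2 nc a3 c0} cd' dl' na cen => [|y1 d'] cd' dl' na cen.
  by move: cd' lt'; rewrite /cycle [fpath _ _ _]/= andbT => /eqP; rewrite -[next l (rho z)]/(sigma z) => ->; rewrite ltnn.
move: cd'; rewrite /cycle [fpath _ _ _]/= => /andP [/eqP sy1 p1].
have {}sy1 : sigma z = y1 by [].
rewrite sy1 in lt' sz.
have y1l : y1 \in l by apply: dl'; rewrite !inE eqxx orbT.
have ry1 : 0 < r y1 by exact: leq_ltn_trans (leq0n _) lt'.
have c1 := central_residue (cen y1 (mem_head _ _)) y1l ry1.
case: d' dl' na cen p1 => [|y2 d'] dl' na cen.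
  rewrite [fpath _ _ _]/= andbT => /eqP sy2; have {}sy2 : sigma y1 = z by [].
  by move: ncz c1 sz; rewrite sy2 /central; clear; lia.
rewrite [fpath _ _ _]/= => /andP [/eqP sy2 p2]; have {}sy2 : sigma y1 = y2 by [].
rewrite sy2 in c1.
have y2l : y2 \in l by apply: dl'; rewrite !inE eqxx !orbT.
have y2d : y2 \in y1 :: y2 :: d' by rewrite !inE eqxx orbT.
have ry2 : 0 < r y2 by move: (residue_lt y1) c1; clear; lia.
have c2 := central_residue (cen y2 y2d) y2l ry2.
(* Neither of the two steps ascends, yet together they return to [r y1]. So both residues are half
   of [T], and the remaining central steps keep this value up to [z], against the ascent from [z] to
   [y1]. *)
have le1 : r y2 <= r y1 by have := na y1 (mem_head _ _); rewrite -ascE // sy2 -leqNgt.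
have le2 : r (sigma y2) <= r y2 by have := na y2 y2d; rewrite -ascE // -leqNgt.
have : r z = r y2.
  apply: central_path p2 _ ry2 _ => //; last by move: c1 c2 le1 le2; clear; lia.
    by move=> t td; apply: dl'; rewrite !inE td !orbT.
  by move=> t td; apply: cen; rewrite inE td orbT.
by move: lt' c1 c2 le1 le2; clear; lia.
Qed.

Lemma tied_const x d : fcycle sigma (x :: d) -> tied (x :: d) ->
  {in x :: d, forall z, r z = r x}.
Proof.
rewrite /cycle /tied => p td z; rewrite inE => /orP [/eqP -> //|].
have claim y s x' : r x' = r x -> fpath sigma x' (rcons s y) ->
    all (fun z => r (sigma z) == r z) (x' :: s) -> z \in s -> r z = r x.
  elim: s x' => // t s IH x' E.
  rewrite [fpath _ _ _]/= => /andP [/eqP sx ps] /= /andP [/eqP tx ts].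
  have Et : r t = r x by rewrite -sx tx E.
  by rewrite inE => /orP [/eqP -> //|]; apply: IH ps ts.
exact: claim p td.
Qed.

(** All letters on a tied disk stem from one and the same letter of [W], so the disk says that its
    power with exponent [size d] is trivial. *)
Lemma tied_size d : disk (fun z => (lam z).2) sigma d -> {subset d <= l} -> tied d -> N <= size d.
Proof.
case: d => [[] //|x d [_ cd pd] dl td].
have xl : x \in l by apply: dl; rewrite mem_head.
have E : map (fun z => (lam z).2) (x :: d) = nseq (size (x :: d)) (lam x).2.
  have -> : nseq (size (x :: d)) (lam x).2 = map (fun=> (lam x).2) (x :: d).
    by elim: (x :: d) => //= ? ? ->.
  apply/eq_in_map => z zd; have := tied_const cd td zd; rewrite /r => /eqP.
  rewrite eqn_modDr => /eqP E; rewrite !lam_nth ?E //; exact: dl.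
apply: (N_le (x := (lam x).2)); first by rewrite lam_nth //; apply: W_ne1; rewrite ltn_mod.
  by [].
by rewrite -gprod_nseq -E.
Qed.

Lemma tied_not_asc d : {subset d <= l} -> tied d -> {in d, forall z, ~~ asc z}.
Proof. by move=> dl /allP td z zd; rewrite -ascE ?dl // (eqP (td z zd)) ltnn. Qed.

Lemma tied_central d : {subset d <= l} -> tied d ->
  {in d, forall z, central z = (r z == 0) || (r z == h)}.
Proof.
move=> dl /allP td z zd; have := eqP (td z zd); rewrite /= residue_next ?rho_in ?dl //.
rewrite /central; have := residue_lt (rho z); rewrite TE.
by case: (eqVneq (r (rho z)) h.*2.-1) => [-> _ <-|_ _ <-]; lia.
Qed.

Variable Ds : seq (seq nat).
Hypothesis DsF : disk_family (fun z => (lam z).2) sigma l Ds.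

Definition tied_at c d := tied d && (r (head 0 d) == c).

Let Ds_sub d : d \in Ds -> {subset d <= l}.
Proof. by move=> dD z zd; case: DsF => _ sub _; apply/sub/flattenP; exists d. Qed.
Let Ds_disk d : d \in Ds -> disk (fun z => (lam z).2) sigma d.
Proof. by case: DsF => _ _; apply. Qed.
Let Ds_uniq d : d \in Ds -> uniq d.
Proof.
case: DsF => uf _ _ dD; move: uf; case/splitPr: dD => D1 D2.
by rewrite flatten_cat /= !cat_uniq => /and3P [_ _ /and3P []].
Qed.
Let tied_at_const c d : d \in Ds -> tied_at c d -> {in d, forall z, r z = c}.
Proof.
move=> dD /andP [td /eqP <-] z; have [_ cd _] := Ds_disk dD.
by case: d dD cd td => // x d dD cd td; apply: tied_const.
Qed.

Let fl_le (P : pred nat) : \sum_(d <- Ds) count P d <= count P l.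
Proof. by rewrite -count_flatten; case: DsF => uf sub _; apply: count_subset. Qed.

Lemma count_sum (X : Type) (P : pred X) s : count P s = \sum_(x <- s) P x.
Proof. by rewrite -sum1_count big_mkcond. Qed.

Lemma untied_le_asc : count (predC tied) Ds <= \sum_(d <- Ds) count asc d.
Proof.
rewrite count_sum big_seq [X in _ <= X]big_seq; apply: leq_sum => d dD /=.
case: (boolP (tied d)) => // nt; have [_ cd _] := Ds_disk dD.
by have [] := not_tied_asc cd (Ds_sub dD) nt.
Qed.

Lemma disk_count1 : count (predC tied) Ds <= n * h - n.
Proof. by rewrite -asc_total; apply: leq_trans untied_le_asc (fl_le _). Qed.

(** Besides an ascent, an untied disk has a non-ascending step; all steps of a tied disk are of this
    kind, and there are at least [N]. *)
Lemma disk_count2 : N * count tied Ds + count (predC tied) Ds <= n * h + n.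
Proof.
have E : count (fun z => ~~ asc z) l = n * h + n.
  have := count_predC asc l; rewrite asc_total size_l TE.
  by rewrite -[count (predC asc) l]/(count (fun z => ~~ asc z) l); nia.
rewrite -E; apply: leq_trans (fl_le _).
rewrite !count_sum big_distrr -big_split /= big_seq [X in _ <= X]big_seq.
apply: leq_sum => d dD; have [_ cd _] := Ds_disk dD.
case: (boolP (tied d)) => [td|nt] /=.
  have -> : count (fun z => ~~ asc z) d = size d.
    by apply/eqP; rewrite -all_count; apply/allP; apply: tied_not_asc => //; apply: Ds_sub.
  by rewrite muln1 addn0; apply: tied_size (Ds_disk dD) (Ds_sub dD) td.
by rewrite muln0; have [] := not_tied_asc cd (Ds_sub dD) nt.
Qed.

(** Disks tied at 0 or [h] consist of central corners and escape the count of noncentral ones. Those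
    at 0 moreover lower the noncentral total, twice per corner by [noncentral_total]; this makes 0
    and [h] enter with opposite signs. The hypothesis says that every ascent is used up by its own
    untied disk. *)
Lemma disk_count3 : count (predC tied) Ds = n * h - n ->
  N * count tied Ds + N * count (tied_at 0) Ds <= 2 * n + N * count (tied_at h) Ds.
Proof.
move=> sE.
pose ac z := asc z && ~~ central z; pose nc z := ~~ asc z && ~~ central z.
pose zc z := (r z == 0) && central z.
have tot := noncentral_total; rewrite -/ac -/nc -/zc in tot.
have h1 : \sum_(d <- Ds) count ac d + 2 * count (predC tied) Ds + N * count tied Ds <=
  \sum_(d <- Ds) count nc d + 2 * (\sum_(d <- Ds) count asc d) + N * count (tied_at 0) Ds
  + N * count (tied_at h) Ds.
  rewrite !count_sum !big_distrr -!big_split /= big_seq [X in _ <= X]big_seq.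
  apply: leq_sum => d dD; have [_ cd _] := Ds_disk dD.
  case: (boolP (tied d)) => [td|nt] /=; last first.
    rewrite /tied_at (negbTE nt) !muln0 !addn0 muln1.
    exact: central_balance cd (Ds_uniq dD) (Ds_sub dD) nt.
  have na := tied_not_asc (Ds_sub dD) td.
  have -> : count ac d = 0.
    apply/eqP; rewrite -leqn0 leqNgt -has_count; apply/hasPn => z zd.
    by rewrite /ac (negbTE (na z zd)).
  rewrite muln0 !add0n muln1.
  have [t0|t0] := boolP (tied_at 0 d); first by rewrite muln1; lia.
  have [th|th] := boolP (tied_at h d); first by rewrite muln1; lia.
  have -> : count nc d = size d.
    apply/eqP; rewrite -all_count; apply/allP => z zd; rewrite /nc na //=.
    rewrite (tied_central (Ds_sub dD) td) //.
    move: t0 th; rewrite /tied_at td /=.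
    by case: d zd td cd {dD na} => // x d zd td cd; rewrite (tied_const cd td zd) /= => /negbTE -> /negbTE ->.
  by have := tied_size (Ds_disk dD) (Ds_sub dD) td; lia.
have h2 : N * count (tied_at 0) Ds <= count zc l.
  apply: leq_trans (fl_le _); rewrite count_sum big_distrr /= big_seq [X in _ <= X]big_seq.
  apply: leq_sum => d dD; case: (boolP (tied_at 0 d)) => [t0|_]; last by rewrite muln0.
  have td : tied d by case/andP: t0.
  have -> : count zc d = size d.
    apply/eqP; rewrite -all_count; apply/allP => z zd.
    by rewrite /zc (tied_central (Ds_sub dD) td) // (tied_at_const dD t0).
  by rewrite muln1; apply: tied_size (Ds_disk dD) (Ds_sub dD) td.
have h3 : count ac l + \sum_(d <- Ds) count asc d <= count asc l + \sum_(d <- Ds) count ac d.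
  pose cc z := asc z && central z.
  have E s : count asc s = count cc s + count ac s.
    by rewrite !count_sum -big_split /=; apply: eq_bigr => z _; rewrite /cc /ac; case: asc; case: central.
  have Es : \sum_(d <- Ds) count asc d = \sum_(d <- Ds) count cc d + \sum_(d <- Ds) count ac d.
    by rewrite -big_split /=; apply: eq_bigr => d _; apply: E.
  by have := fl_le cc; rewrite Es E; lia.
have h4 := fl_le nc; have h5 := untied_le_asc; have h6 := fl_le asc; have h7 := asc_total.
by lia.
Qed.
End PeriodicDiagram.

Lemma modn_shift_eq T a b x : a < T -> x < T -> b < T ->
  ((a + (T - x)) %% T == b) = (a == (b + x) %% T).
Proof.
move=> aT xT bT; case: (leqP x a) => xa.
  have -> : a + (T - x) = (a - x) + T by lia.
  rewrite modnDr modn_small; last by lia.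
  case: (ltnP (b + x) T) => bx; first by rewrite modn_small //; lia.
  have -> : b + x = (b + x - T) + T by lia.
  by rewrite modnDr modn_small; lia.
rewrite modn_small; last by lia.
case: (ltnP (b + x) T) => bx; first by rewrite modn_small //; lia.
have -> : b + x = (b + x - T) + T by lia.
by rewrite modnDr modn_small; lia.
Qed.

(** * Combining the three counts *)

Section Bound.
Variables (G : Group) (W : seq (bool * G)) (n h N k : nat).
Local Notation e := (gone G).
Local Notation T := (size W).
Hypothesis h_gt0 : 0 < h.
Hypothesis TE : T = h.*2.
Hypothesis W_typ : forall i, i < T -> (nth (true, e) W i).1 = ~~ odd i.
Hypothesis W_ne1 : forall i, i < T -> (nth (true, e) W i).2 <> e.
Hypothesis N_le : forall (x : G) j, x <> e -> 0 < j -> gpow G x j = e -> N <= j.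
Hypothesis n_gt0 : 0 < n.
Hypothesis N_gt1 : 1 < N.

Lemma residue_shift l sh z : residue W l sh z = (residue W l 0 z + sh) %% T.
Proof. by rewrite /residue addn0 modnDml. Qed.

Lemma tied_shift l rho sh d : tied W l rho sh d = tied W l rho 0 d.
Proof.
apply: eq_all => z; rewrite residue_shift [residue _ _ _ z]residue_shift eqn_modDr.
by rewrite !modn_small //; apply: residue_lt h_gt0 TE _ _.
Qed.

Theorem drawable_bound : drawable (flatten (nseq n W)) k -> n %/ 2 - n %/ N + 1 <= k.
Proof.
case=> l [lam [rho [m [Dg lamE mv]]]].
rewrite (moved_all h_gt0 TE W_typ Dg lamE 0) TE in mv.
have [_ _ _ [Ds szm DsF]] := Dg.
rewrite leqNgt; apply/negP => klt.
have c1 := disk_count1 h_gt0 TE W_typ Dg lamE 0 DsF.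
have c2 := disk_count2 h_gt0 TE W_typ W_ne1 N_le Dg lamE 0 DsF.
have c0 := count_predC (tied W l rho 0) Ds.
set t := count (tied W l rho 0) Ds in c0 c2.
set dn := count (predC _) Ds in c0 c1 c2.
set q := n %/ N in klt.
have nE : n = q * N + n %% N := divn_eq n N.
have rlt : n %% N < N by rewrite ltn_mod; lia.
have qn : q <= n %/ 2 by apply: leq_div2l.
have k2 : 2 * k + 2 * q <= n by lia.
rewrite -muln2 mulnA in mv.
have mt : m <= t + dn by rewrite c0.
(* [mv] amounts to [n * h + 1 <= m + 2 * k]: after [n * h] cuts, the Euler characteristic of a
   surface of genus [k] with one boundary curve is at most the number of disks. *)
have dnge : n * h + 1 + 2 * q <= dn + t + n by lia.
have hn : n <= n * h by rewrite leq_pmulr.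
have t1 : 2 * q + 1 <= t by lia.
(* Otherwise the second count would give [2 * N * (q + 1) <= 2 * n + 1], hence
   [N * (q + 1) <= n]. *)
have t2 : t < 2 * q + 2 by nia.
have tE : t = 2 * q + 1 by lia.
have dnE : dn = n * h - n by lia.
pose tx x := count (tied_at W l rho 0 x) Ds.
have tsum : \sum_(x < T) tx x = t.
  rewrite /tx /t; under eq_bigr do rewrite count_sum.
  rewrite exchange_big /= count_sum; apply: eq_bigr => d _; rewrite /tied_at.
  case: (tied W l rho 0 d) => /=; last by rewrite big1.
  have rT : residue W l 0 (head 0 d) < T by apply: residue_lt h_gt0 TE _ _.
  rewrite (bigD1 (Ordinal rT)) //= eqxx big1 ?addn0 // => i.
  by rewrite eq_sym -val_eqE /= => /negbTE ->.
(* Since [t] is odd, some two opposite residues carry different numbers of tied disks. *)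
have [x xh tne] : exists2 x, x < h & tx x != tx (x + h).
  have [|] := boolP [exists x : 'I_h, tx x != tx (x + h)].
    by case/existsP => x xx; exists (x : nat).
  rewrite negb_exists => /forallP eqt; exfalso.
  have : t = (\sum_(x < h) tx x).*2.
    rewrite -tsum TE -addnn big_split_ord /= -addnn; congr (_ + _).
    apply: eq_bigr => i _; rewrite addnC; apply/esym/eqP.
    by have := eqt i; rewrite negbK.
  by lia.
(* The shift [T - c] moves [c] to residue 0 and its opposite to [h]. The third count then gives
   [N * (t + 1) <= 2 * n], impossible as [t + 1 = 2 * (q + 1)]. *)
have final c : c < T -> tx ((h + c) %% T) < tx c -> False.
  move=> cT lt.
  have := disk_count3 h_gt0 TE W_typ W_ne1 N_le Dg lamE (sh := T - c) DsF.
  rewrite (eq_count (tied_shift l rho (T - c))) -/t.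
  rewrite (eq_count (a2 := predC (tied W l rho 0))); last first.
    by move=> d /=; rewrite tied_shift.
  have E b : b < T -> count (tied_at W l rho (T - c) b) Ds = tx ((b + c) %% T).
    move=> bT; apply: eq_count => d; rewrite /tied_at tied_shift residue_shift modn_shift_eq //.
    exact: residue_lt h_gt0 TE _ _.
  rewrite -/dn !E ?add0n ?(modn_small cT) //; try lia.
  by move=> /(_ dnE) H; nia.
case: (ltngtP (tx x) (tx (x + h))) tne => // lt _.
  apply: (final (x + h)); first by rewrite TE; lia.
  by rewrite addnCA addnn -TE modnDr modn_small // TE; lia.
apply: (final x); first by rewrite TE; lia.
by rewrite addnC modn_small // TE; lia.
Qed.
End Bound.

(** * Words in a free product *)

Section FreeProduct.
Variables (G : Group) (J : Type) (A : J -> G -> Prop).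
Hypothesis FP : is_free_product G A.
Local Notation "x ** y" := (gmul G x y) (at level 40, left associativity).
Local Notation "x ^-" := (ginv G x) (at level 3, format "x ^-").
Local Notation e := (gone G).
Local Notation word := (seq (J * G)).
Local Notation prod := (@word_prod G J).
Local Notation reduced := (reduced_word G A).
Implicit Types (w f : word) (p q : J * G).

Definition factor_word w := List.Forall (fun p => A p.1 p.2) w.

Definition head_neq j w := match w with [::] => True | q :: _ => j <> q.1 end.

Lemma reduced_cons p w : reduced (p :: w) <->
  [/\ A p.1 p.2, p.2 <> e, reduced w & head_neq p.1 w].
Proof.
rewrite /reduced_word; case: p => j a; split.
  case=> F al; inversion F as [|? ? [Aa ae] F']; subst; split=> //=; last by case: w al {F F'} => // -[j' b] w /= [].
  by split=> //; case: w al {F F'} => // -[j' b] w /= [].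
case=> /= Aa ae [F al] hn; split; first by constructor.
by case: w al hn {F} => // -[j' b] w.
Qed.

Lemma prod_cat w1 w2 : prod (w1 ++ w2) = prod w1 ** prod w2.
Proof. by elim: w1 => [|[j a] w IH] /=; rewrite ?gmul1l // IH gmulA. Qed.

Lemma reduced_factor w : reduced w -> factor_word w.
Proof. by case=> F _; apply: List.Forall_impl F => p []. Qed.

Lemma A1 j : A j e. Proof. by case: FP => /(_ j) []. Qed.
Lemma AM j x y : A j x -> A j y -> A j (x ** y).
Proof. by case: FP => /(_ j) [_ [H _]] _; apply: H. Qed.
Lemma AV j x : A j x -> A j x^-.
Proof. by case: FP => /(_ j) [_ [_ H]] _; apply: H. Qed.

(** [P] is carried along because [typed_expand] must reduce a word without leaving the factors of
    one type. *)
Lemma reduce_word (P : J -> Prop) w : factor_word w -> List.Forall (fun p => P p.1) w ->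
  exists w', [/\ reduced w', prod w' = prod w, size w' <= size w & List.Forall (fun p => P p.1) w'].
Proof.
elim: w => [|[j a] w IH] F Pw; first by exists [::].
inversion F as [|? ? Aa F']; inversion Pw as [|? ? Pj Pw']; subst; move: Aa Pj => /= Aa Pj.
have [w' [rw pw sw Pw'']] := IH F' Pw'.
have [->|ae] := classic (a = e).
  by exists w'; split=> //=; [rewrite gmul1l|lia].
case: w' rw pw sw Pw'' => [|[j' b] w'] rw pw sw Pw''.
  exists [:: (j, a)]; split; [by apply/reduced_cons; split|by rewrite /= -pw| |by constructor].
  by move: sw => /=; lia.
have [jj|jj] := classic (j = j'); last first.
  exists ((j, a) :: (j', b) :: w').
  split; [by apply/reduced_cons; split|by rewrite /= -pw| |by constructor].
  by move: sw => /=; lia.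
subst j'; move/reduced_cons: (rw) => [/= Ab be rw' hn].
inversion Pw'' as [|? ? _ Pw3]; subst.
have [ab|ab] := classic (a ** b = e).
  exists w'; split=> //=; last by move: sw => /=; lia.
  by rewrite -pw /= gmulA ab gmul1l.
exists ((j, a ** b) :: w'); split; last by constructor.
- by apply/reduced_cons; split=> //=; apply: AM.
- by rewrite /= -pw /= gmulA.
- by move: sw => /=; lia.
Qed.

Lemma reduced_uniq w w' : reduced w -> reduced w' -> prod w = prod w' -> w = w'.
Proof. by case: FP => _ [_ H]; apply: H. Qed.

Lemma reduced_exists g : exists2 w, reduced w & prod w = g.
Proof. by case: FP => _ [/(_ g) [w [rw pw]] _]; exists w. Qed.

Lemma reduced_size w w' : reduced w -> factor_word w' -> prod w = prod w' -> size w <= size w'.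
Proof.
move=> rw F E; have [|w2 [r2 p2 s2 _]] := @reduce_word (fun=> True) w' F.
  by apply: List.Forall_impl F.
by rewrite (reduced_uniq rw r2) // E p2.
Qed.

Definition joinable w1 w2 := forall u p q v, w1 = rcons u p -> w2 = q :: v -> p.1 <> q.1.

Lemma reduced_cat w1 w2 : reduced w1 -> reduced w2 -> joinable w1 w2 -> reduced (w1 ++ w2).
Proof.
elim: w1 => //= p w1 IH /reduced_cons [Ap pe r1 hn] r2 jn.
apply/reduced_cons; split=> //.
  by apply: IH => // u p' q v E; apply: (jn (p :: u)); rewrite E.
case: w1 hn {IH r1} jn => //= _ jn; case: w2 {r2} jn => //= q v jn.
exact: (jn [::]).
Qed.

Definition cyclically_reduced W := [/\ reduced W, 1 < size W & joinable W W].

Lemma power_word_cat_joinable W n : cyclically_reduced W -> joinable W (flatten (nseq n W)).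
Proof.
case=> _ s jn; case: n => [|n] u p q v //=.
case: W s jn => // q' W _ jn E [<- _]; exact: jn E (erefl _).
Qed.

Lemma power_word_reduced W n : cyclically_reduced W -> reduced (flatten (nseq n W)).
Proof.
move=> cW; elim: n => [|n IH] /=; first by split; constructor.
by apply: reduced_cat => //; [case: cW|apply: power_word_cat_joinable].
Qed.

Lemma prod_power W n : prod (flatten (nseq n W)) = gpow G (prod W) n.
Proof. by elim: n => //= n IH; rewrite prod_cat IH. Qed.

Definition word_inv w : word := rev (map (fun p => (p.1, p.2^-)) w).

Lemma prod_inv w : prod (word_inv w) = (prod w)^-.
Proof.
elim: w => [|[j a] w IH] /=; first by rewrite ginv1.
by rewrite /word_inv /= rev_cons -cats1 prod_cat -/(word_inv w) IH /= gmul1r ginvM.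
Qed.

Lemma Forall_rev (P : J * G -> Prop) w : List.Forall P w -> List.Forall P (rev w).
Proof.
elim: w => // p w IH F; inversion F; subst; rewrite rev_cons -cats1.
by apply/List.Forall_app; split; [apply: IH|constructor].
Qed.

Lemma factor_word_inv w : factor_word w -> factor_word (word_inv w).
Proof.
move=> F; apply: Forall_rev; elim: w F => //= p w IH F; inversion F; subst.
by constructor; [apply: AV|apply: IH].
Qed.

Lemma conjK x g : g = x ** conj G g x ** x^-.
Proof. by rewrite /conj gmulKV -gmulA gmulVr gmul1r. Qed.
Lemma gpow_conj x g n : gpow G (x ** g ** x^-) n = x ** gpow G g n ** x^-.
Proof.
elim: n => [|n IH] /=; first by rewrite gmul1r gmulVr.
by rewrite IH -!gmulA gmulVK.
Qed.
Lemma conj_gpow x g n : conj G (gpow G g n) x = gpow G (conj G g x) n.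
Proof.
by have := gpow_conj x^- g n; rewrite ginvK /conj -!gmulA => ->.
Qed.
Lemma gpowA j a n : A j a -> A j (gpow G a n).
Proof. by move=> Aa; elim: n => [|n IH] /=; [apply: A1|apply: AM]. Qed.

Lemma gpow_cyc_length W n w : cyclically_reduced W -> factor_word w ->
  gpow G (prod W) n = prod w -> 2 * n <= size w.
Proof.
move=> cW F E; have := reduced_size (power_word_reduced n cW) F.
rewrite prod_power => /(_ E); rewrite size_flatten_nseq; case: cW => _ s _.
by move=> le; apply: leq_trans le; rewrite mulnC leq_mul2l s orbT.
Qed.

(** The [n]-th power of [W] has length at least [2 * n], whereas all powers of a conjugate by [X] of
    an element of a factor have length at most [2 * size X + 1]. *)
Lemma cyclically_reduced_hat W : cyclically_reduced W -> hatG G A (prod W).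
Proof.
move=> cW j x Aa; have [X rX pX] := reduced_exists x.
have [n nE] : exists n, n = (size X).+1 by exists (size X).+1.
have := @gpow_cyc_length W n (X ++ (j, gpow G (conj G (prod W) x) n) :: word_inv X) cW.
rewrite size_cat /= size_rev size_map => H.
suff : 2 * n <= size X + (size X).+1 by rewrite nE; lia.
apply: H.
  apply/List.Forall_app; split; first exact: reduced_factor.
  constructor; first exact: gpowA.
  by apply: factor_word_inv; apply: reduced_factor.
by rewrite prod_cat /= prod_inv pX {1}(conjK x (prod W)) gpow_conj gmulA.
Qed.

Lemma cyclically_reduced_power W n : 0 < n -> cyclically_reduced W ->
  cyclically_reduced (flatten (nseq n W)).
Proof.
case: n => // n _ cW; split; first exact: power_word_reduced.
  by rewrite size_flatten_nseq; case: cW => _ s _; apply: leq_trans s _; rewrite leq_pmull.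
move=> u p q v E1; case: W cW E1 => [[] //|q' W] cW E1 /= [<- _].
have [_ _ jn] := cW.
have : exists u', q' :: W = rcons u' p.
  have WE : q' :: W = rcons (belast q' W) (last q' W) := lastI _ _.
  move: E1; rewrite -[n.+1]addn1 nseqD flatten_cat [flatten (nseq 1 _)]/= cats0.
  rewrite {2}WE -rcons_cat => /rcons_inj [_ <-].
  by exists (belast q' W).
by case=> u' E; apply: jn E (erefl _).
Qed.

Lemma conj_conj g x y : conj G (conj G g x) y = conj G g (x ** y).
Proof. by rewrite /conj ginvM !gmulA. Qed.

(** Conjugation by the first letter carries it to the end of the word. If first and last letter
    share a factor, they fuse there and the word gets shorter. *)
Lemma cyclic_reduction (j0 : J) g :
  (exists j x, A j (conj G g x)) \/ (exists x W, cyclically_reduced W /\ conj G g x = prod W).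
Proof.
have [w rw pw] := reduced_exists g.
elim: {w}(size w) {-2}w (leqnn (size w)) g rw pw => [|s IH] w sw g rw pw.
  case: w sw pw rw => //= _ <- _; left; exists j0, e.
  by rewrite /conj gmul1r gmulVl; apply: A1.
case: w sw rw pw => [|[j a] w] sw rw pw.
  by left; exists j0, e; rewrite -pw /conj gmul1l gmulVl; apply: A1.
case/lastP: w sw rw pw => [|u [j' b]] sw rw pw.
  left; exists j, e; rewrite /conj gmul1r ginv1 gmul1l -pw /= gmul1r.
  by case/reduced_cons: rw.
have [jj|jj] := classic (j' = j); last first.
  right; exists e, ((j, a) :: rcons u (j', b)); split; last by rewrite pw /conj gmul1r ginv1 gmul1l.
  split=> //; first by rewrite /= size_rcons.
  by move=> u' p q v; rewrite -rcons_cons => /rcons_inj [_ <-] [<- _].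
subst j'; have Fw := reduced_factor rw.
inversion Fw as [|? ? Aa Fr]; subst.
have : factor_word u /\ A j b.
  by move: Fr; rewrite -cats1 => /List.Forall_app [Fu Fb]; inversion Fb; subst.
case=> Fu Ab.
have [||w2 [r2 p2 s2 _]] := @reduce_word (fun=> True) (u ++ [:: (j, b ** a)]).
- by apply/List.Forall_app; split=> //; constructor=> //; apply: AM.
- by apply/List.Forall_forall.
have [||[j' [x Ax]]|[x [W [cW pW]]]] := IH w2 _ (conj G (prod ((j, a) :: rcons u (j, b))) a) r2.
- by move: s2 sw; rewrite /= size_rcons size_cat /=; lia.
- by rewrite p2 -cats1 /= !prod_cat /= !gmul1r /conj -!gmulA gmulVK.
- by left; exists j', (a ** x); rewrite -conj_conj.
by right; exists (a ** x), W; rewrite -conj_conj.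
Qed.

(** * One factor against all the others *)

Section TwoTypes.
Variable j1 : J.

Definition typ (j : J) : bool := if excluded_middle_informative (j = j1) then true else false.

Local Notation tword := (seq (bool * G)).
Implicit Types (t : tword) (c : bool * G).
Local Notation tprod t := (gprod (map snd t)).

(** Membership in [A j1] or in the subgroup generated by the other factors, given by a word so that
    it can be expanded again. *)
Definition typed_letter c := exists f,
  [/\ factor_word f, List.Forall (fun p => typ p.1 = c.1) f & prod f = c.2].
Definition typed_word t := List.Forall typed_letter t.

Lemma typed_letter1 b : typed_letter (b, e).
Proof. by exists [::]; split; constructor. Qed.

Lemma typed_letterM b x y : typed_letter (b, x) -> typed_letter (b, y) -> typed_letter (b, x ** y).
Proof.
case=> f [F1 T1 /= <-] [f' [F2 T2 /= <-]]; exists (f ++ f').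
by split; [apply/List.Forall_app..|rewrite prod_cat].
Qed.

Lemma typed_letterV b x : typed_letter (b, x) -> typed_letter (b, x^-).
Proof.
case=> f [F T /= <-]; exists (word_inv f); split; last by rewrite prod_inv.
  exact: factor_word_inv.
apply: Forall_rev; elim: f T {F} => //= p f IH T; inversion T; subst.
by constructor; [|apply: IH].
Qed.

Definition typed_of f : tword := map (fun p => (typ p.1, p.2)) f.

Lemma typed_of_word f : factor_word f -> typed_word (typed_of f).
Proof.
elim: f => [|p f IH] F; first by constructor.
inversion F; subst; constructor; last exact: IH.
exists [:: p]; split; [by constructor|by constructor|].
by case: (p) => j a /=; rewrite gmul1r.
Qed.

Lemma tprod_typed_of f : tprod (typed_of f) = prod f.
Proof. by elim: f => [|[j a] f IH] //=; rewrite -IH. Qed.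

Lemma tprod_cons c t : tprod (c :: t) = c.2 ** tprod t.
Proof. by []. Qed.

Lemma tprod_cat t1 t2 : tprod (t1 ++ t2) = tprod t1 ** tprod t2.
Proof. by rewrite map_cat gprod_cat. Qed.

Lemma winv_typed t : typed_word t -> typed_word (winv t).
Proof.
elim: t => [|[b a] t IH] F; first by constructor.
inversion F; subst; rewrite /winv /= rev_cons -cats1; apply/List.Forall_app.
by split; [apply: IH|constructor=> //; apply: typed_letterV].
Qed.

Lemma tprod_winv t : tprod (winv t) = (tprod t)^-.
Proof. by rewrite /winv map_rev -gprod_rev_inv; congr (gprod (rev _)); rewrite -!map_comp. Qed.

Lemma comms_drawable k g : prod_comms G k g ->
  exists t, [/\ t <> [::], typed_word t, drawable t k & tprod t = g].
Proof.
elim: k g => [|k IH] g /=.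
  move=> ->; exists [:: (true, e)]; split=> //; last by rewrite /= gmul1l.
    by constructor=> //; apply: typed_letter1.
  exact: drawable1.
case=> x [y [g' [/IH [[|c t] [// _ Ft Dt pt]] ->]]].
have [X rX pX] := reduced_exists x; have [Y rY pY] := reduced_exists y.
pose X' := typed_of X; pose Y' := typed_of Y.
have FX : typed_word X' by apply/typed_of_word/reduced_factor.
have FY : typed_word Y' by apply/typed_of_word/reduced_factor.
exists ((c.1, e) :: winv X' ++ (c.1, e) :: winv Y' ++ (c.1, e) :: X' ++ (c.1, e) :: Y' ++ c :: t).
split=> //; last first.
- rewrite !(tprod_cons, tprod_cat) !tprod_winv !tprod_typed_of pX pY.
  by rewrite -pt tprod_cons /comm /= !gmul1l -!gmulA.
- exact: drawable_handle.
have c1 := typed_letter1 c.1.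
by do 4!(constructor=> //; apply/List.Forall_app; split; [by [|apply: winv_typed]|]).
Qed.

Definition typed_reduced t :=
  (forall t1 c t2, t = t1 ++ c :: t2 -> c.2 <> e) /\
  (forall t1 c d t2, t = t1 ++ c :: d :: t2 -> c.1 <> d.1).

(** Nontriviality of the product ensures that deleting a trivial letter never empties the word,
    which would have no diagram to draw. *)
Lemma drawable_reduce k t : typed_word t -> drawable t k -> tprod t <> e ->
  exists t', [/\ typed_word t', drawable t' k, tprod t' = tprod t & typed_reduced t'].
Proof.
elim: {t}(size t) {-2}t (leqnn (size t)) => [|s IH] t st Ft Dt pt.
  by case: t st pt {Ft Dt}.
have [rt|nrt] := classic (typed_reduced t); first by exists t.
case: (not_and_or _ _ nrt) => /not_all_ex_not [t1] /not_all_ex_not [c] /not_all_ex_not.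
  case=> t2 H; have [tE /NNPP ce] := imply_to_and _ _ H.
  case: c ce tE {H} => b a /= -> tE; subst t.
  have pE : tprod (t1 ++ t2) = tprod (t1 ++ (b, e) :: t2).
    by rewrite !tprod_cat /= gmul1l.
  case/List.Forall_app: Ft => F1 F2; inversion F2; subst.
  have ne : t1 ++ t2 <> [::] by move=> E; apply: pt; rewrite -pE E.
  have [|||| t' [h1 h2 h3 h4]] := IH (t1 ++ t2).
  - by move: st; rewrite !size_cat /=; lia.
  - by apply/List.Forall_app.
  - exact: drawable_del Dt.
  - by rewrite pE.
  by exists t'; rewrite -pE.
case=> d /not_all_ex_not [t2 H]; have [tE /NNPP cd] := imply_to_and _ _ H.
case: c cd tE {H} => b x; case: d => b' y /= <- tE; subst t.
have pE : tprod (t1 ++ (b, x ** y) :: t2) = tprod (t1 ++ (b, x) :: (b, y) :: t2).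
  by rewrite !tprod_cat !tprod_cons /= -(gmulA G x y).
case/List.Forall_app: Ft => F1 F2; inversion F2 as [|? ? Vx F3]; inversion F3 as [|? ? Vy F4]; subst.
have [|||| t' [h1 h2 h3 h4]] := IH (t1 ++ (b, x ** y) :: t2).
- by move: st; rewrite !size_cat /=; lia.
- by apply/List.Forall_app; split=> //; constructor=> //; apply: typed_letterM.
- exact: drawable_merge Dt.
- by rewrite pE.
by exists t'; rewrite -pE.
Qed.

Fixpoint compress f : tword :=
  match f with
  | [::] => [::]
  | p :: f' => match compress f' with
    | [::] => [:: (typ p.1, p.2)]
    | c :: t => if c.1 == typ p.1 then (c.1, p.2 ** c.2) :: t else (typ p.1, p.2) :: c :: t
    end
  end.

Lemma compress_cons p f : exists x t, compress (p :: f) = (typ p.1, x) :: t.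
Proof.
rewrite /=; case: (compress f) => [|c t]; first by exists p.2, [::].
by case: ifP => [/eqP ->|_]; [exists (p.2 ** c.2), t|exists p.2, (c :: t)].
Qed.

Lemma compress_rcons f p : exists t x, compress (rcons f p) = rcons t (typ p.1, x).
Proof.
elim: f => [|q f [t [x E]]] /=; first by exists [::], p.2.
rewrite E; case: t E => [|c t] E /=.
  case: ifP => [/eqP ->|_]; first by exists [::], (q.2 ** x).
  by exists [:: (typ q.1, q.2)], x.
by case: ifP => _; [exists ((c.1, q.2 ** c.2) :: t), x|exists ((typ q.1, q.2) :: c :: t), x].
Qed.

Definition typ_joinable f1 f2 := forall u p q v, f1 = rcons u p -> f2 = q :: v -> typ p.1 <> typ q.1.

Lemma compress_cat f1 f2 : typ_joinable f1 f2 -> compress (f1 ++ f2) = compress f1 ++ compress f2.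
Proof.
elim: f1 => //= p f1 IH jn.
rewrite IH; last by move=> u p' q v E; apply: (jn (p :: u)); rewrite E.
case: f1 jn {IH} => [|p' f1] jn /=.
  case: f2 jn => // q f2 jn; have [x [t ->]] := compress_cons q f2.
  by rewrite ifN //=; apply/eqP => E; apply: (jn [::] p q f2).
have [x [t E]] := compress_cons p' f1; move: E => /= ->.
by rewrite cat_cons; case: ifP.
Qed.

Lemma compress_block b f : f <> [::] -> List.Forall (fun p => typ p.1 = b) f ->
  compress f = [:: (b, prod f)].
Proof.
elim: f => // -[j a] f IH _ F; inversion F as [|? ? tj F']; subst.
case: f IH F' {F} => [_ _|p f IH F'] /=; first by rewrite gmul1r.
have /= -> := IH _ F'; last by [].
by rewrite /= eqxx.
Qed.

(** This replaces a proof that [G] is a free product of two groups. Adjacent letters have different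
    types, hence their expansions involve different factors and concatenate to a reduced word. *)
Lemma typed_expand t : typed_word t -> typed_reduced t ->
  exists f, [/\ reduced f, prod f = tprod t & compress f = t].
Proof.
elim: t => [|c t IH] F [ne al]; first by exists [::]; split=> //; split; constructor.
inversion F as [|? ? Vc Ft]; subst.
have [|f [rf pf cf]] := IH Ft.
  split=> [t1 d t2 E|t1 d d' t2 E]; first by apply: (ne (c :: t1)); rewrite E.
  by apply: (al (c :: t1)); rewrite E.
have [f0 [F0 T0 p0]] := Vc.
have [fc [rc pc _ Tc]] := @reduce_word (fun j => typ j = c.1) f0 F0 T0.
have fc0 : fc <> [::] by move=> E; apply: (ne [::] c t) => //; rewrite -p0 -pc E.
have last_typ u p : fc = rcons u p -> typ p.1 = c.1.
  by move=> E; move: Tc; rewrite E -cats1 => /List.Forall_app [_ Fp]; inversion Fp.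
have tj : typ_joinable fc f.
  move=> u p q v /last_typ -> fE; have [x [t' E]] := compress_cons q v.
  by rewrite -fE cf in E; apply: (al [::] c (typ q.1, x) t'); rewrite /= E.
exists (fc ++ f); split.
- by apply: reduced_cat => // u p q v E1 E2 Epq; apply: tj E1 E2 _; rewrite Epq.
- by rewrite prod_cat pf pc p0.
- by rewrite compress_cat // cf (compress_block fc0 Tc) pc p0; case: (c).
Qed.
End TwoTypes.
End FreeProduct.

(** * Products of commutators *)

Section Commutators.
Variable G : Group.
Local Notation "x ** y" := (gmul G x y) (at level 40, left associativity).
Local Notation "x ^-" := (ginv G x) (at level 3, format "x ^-").
Local Notation e := (gone G).
Local Notation C := (prod_comms G).
Implicit Types (x y z g u v : G).

Ltac gsimp := rewrite /comm /conj ?(ginvM, ginvK, ginv1, gmul1l, gmul1r) -?gmulA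
  ?(gmulKV, gmulVK, gmulVl, gmulVr, gmul1l, gmul1r).

Lemma comms_conj k x z : C k x -> C k (conj G x z).
Proof.
elim: k x => [|k IH] x /=; first by move=> ->; gsimp.
case=> a [b [x' [/IH h ->]]]; exists (conj G a z), (conj G b z), (conj G x' z); split=> //.
by gsimp; rewrite ?gmulKV.
Qed.

Lemma commsM k l x y : C k x -> C l y -> C (k + l) (x ** y).
Proof.
elim: k x => [|k IH] x /=; first by move=> ->; rewrite gmul1l.
case=> a [b [x' [/IH h ->]]] hy; exists a, b, (x' ** y); split; first exact: h.
by rewrite gmulA.
Qed.

Lemma comms1 x y : C 1 (comm G x y).
Proof. by exists x, y, e; rewrite gmul1r. Qed.

Lemma comms0 : C 0 e. Proof. by []. Qed.

Lemma comms_le k l x : k <= l -> C k x -> C l x.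
Proof.
move=> kl Ck; rewrite -(subnK kl) addnC -[x]gmul1r; apply: commsM => //.
elim: (l - k) => //= j IH; exists e, e, e; split=> //.
by gsimp.
Qed.

Lemma comms_mulC k x y : C k (x ** y) -> C k (y ** x).
Proof. by move/(comms_conj x); gsimp. Qed.

(** A congruence graded by the number of commutators spent; the grades add up under products and
    transitivity. *)
Definition equiv k x y := C k (x ** y^-).

Lemma equiv_refl x : equiv 0 x x. Proof. by rewrite /equiv gmulVr. Qed.
Lemma equiv_trans k l x y z : equiv k x y -> equiv l y z -> equiv (k + l) x z.
Proof. by move=> h1 h2; have := commsM h1 h2; rewrite -gmulA gmulVK. Qed.
Lemma equivM k l x x' y y' : equiv k x x' -> equiv l y y' -> equiv (k + l) (x ** y) (x' ** y').
Proof.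
move=> h1 h2; have := commsM h1 (comms_conj x'^- h2).
by rewrite /equiv; gsimp.
Qed.
Lemma equivMl k x y y' : equiv k y y' -> equiv k (x ** y) (x ** y').
Proof. by move=> h; apply: equivM (equiv_refl x) h. Qed.
Lemma equivMr k x y y' : equiv k y y' -> equiv k (y ** x) (y' ** x).
Proof. by move=> h; rewrite -[k]addn0; apply: equivM h (equiv_refl x). Qed.
Lemma equiv_comms k l x y : equiv k x y -> C l y -> C (k + l) x.
Proof. by move=> h1 h2; have := commsM h1 h2; rewrite -gmulA gmulVl gmul1r. Qed.
Lemma equiv1_comms k x y : equiv k x y -> y = e -> C k x.
Proof. by move=> /[swap] ->; rewrite /equiv ginv1 gmul1r. Qed.
Lemma equiv_conj k x y z : equiv k x y -> equiv k (conj G x z) (conj G y z).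
Proof. by move/(comms_conj z); rewrite /equiv; gsimp. Qed.
Lemma equiv_conj1 x z : equiv 1 (conj G x z) x.
Proof.
rewrite /equiv; have := comms1 z x^-; gsimp => //.
Qed.
(* A single commutator exchanges the outer two of three consecutive blocks. *)
Lemma equiv_swap x y z : equiv 1 (x ** y ** z) (z ** y ** x).
Proof.
rewrite /equiv; have := comms1 (y^- ** x^-) (x ** z^-).
by gsimp.
Qed.

Lemma gpowD x m n : gpow G x (m + n) = gpow G x m ** gpow G x n.
Proof. by elim: m => [|m IH] /=; rewrite ?gmul1l // IH gmulA. Qed.
Lemma gpow1 x : gpow G x 1 = x. Proof. by rewrite /= gmul1r. Qed.
Lemma gpowSr x n : gpow G x n.+1 = gpow G x n ** x.
Proof. by rewrite -addn1 gpowD gpow1. Qed.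
Lemma gpow_conj_inv x b n : gpow G (conj G x^- b) n = conj G (gpow G x n)^- b.
Proof.
elim: n => [|n IH]; first by rewrite /=; gsimp.
by rewrite [gpow _ _ n.+1]/= IH gpowSr; gsimp.
Qed.
Lemma gpow_pred x n : gpow G x n.+1 = e -> gpow G x n = x^-.
Proof. exact: gmul_eq1_inv. Qed.

(** * Powers of a commutator written as [u ** v] *)

Section PowersOfUV.
Variables u b : G.
Let v := conj G u^- b.
Local Notation P := (gpow G (u ** v)).
Local Notation P' := (gpow G (v ** u)).
Let Q j := P j ** u.

Lemma comms_uv r : C 1 (gpow G u r ** gpow G v r).
Proof.
rewrite gpow_conj_inv; apply: comms_mulC; rewrite -[X in _ ** X]ginvK.
exact: equiv_conj1.
Qed.

Lemma comms_step k n : C k (P n) -> C k.+1 (P n.+1).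
Proof.
by move=> h; rewrite gpowSr -addn1; apply: commsM => //; have := comms_uv 1; rewrite !gpow1.
Qed.

Lemma equiv_odd r : equiv r (P r.*2.+1) (gpow G u r.*2.+1 ** gpow G v r.*2.+1).
Proof.
elim: r => [|r IH]; first by rewrite !gpow1; apply: equiv_refl.
rewrite doubleS; move: r.*2.+1 IH => m IH.
have E : P m.+2 = P m ** (u ** v ** u ** v) by rewrite !gpowSr; gsimp.
rewrite E -[r.+1]addn1; apply: equiv_trans (equivMr _ IH) _.
(* Exchanging [v ^ m] with the later [u] across [u ** v] sorts all letters [u] to the left, at the
   price of one commutator for two more factors. *)
have S := equiv_swap (gpow G v m) (u ** v) u.
have := equivMl (gpow G u m) (equivMr v S); congr (equiv _ _ _); first by gsimp.
by rewrite [gpow G v _.+2]gpowSr [gpow G v _.+1]/= !(gpowSr u); gsimp.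
Qed.

Lemma P'_Q n : P' n.+1 = v ** Q n.
Proof.
elim: n => [|n IH]; first by rewrite /Q gpow1 gmul1l.
by rewrite [P' _]/= -[v ** u ** P' n]/(P' n.+1) IH /Q /=; gsimp.
Qed.

Lemma Q_add i j : Q (i + j) = P i ** Q j.
Proof. by rewrite /Q gpowD gmulA. Qed.

Lemma Q_P' j n : Q j ** P' n = Q (j + n).
Proof.
elim: n => [|n IH]; first by rewrite addn0 gmul1r.
by rewrite gpowSr gmulA IH addnS /Q gpowSr; gsimp.
Qed.

Definition conj_equiv k x y := exists z, equiv k x (conj G y z).

Lemma conj_equiv_trans k l x y t : conj_equiv k x y -> conj_equiv l y t -> conj_equiv (k + l) x t.
Proof.
case=> z h1 [z' h2]; exists (z' ** z).
have -> : conj G t (z' ** z) = conj G (conj G t z') z by gsimp.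
exact: equiv_trans h1 (equiv_conj z h2).
Qed.

(** Since [u (v u)^n = (u v)^n u], the long word is [P i ** Q j ** P' n], and conjugation brings the
    two inserted ends together. *)
Lemma Q_insert k i j n : C k (P i ** P' n) -> conj_equiv k (Q (i + j + n)) (Q j).
Proof.
move=> h; exists (P i)^-; rewrite -Q_P' Q_add.
have -> : P i ** Q j ** P' n = conj G (Q j ** (P' n ** P i)) (P i)^- by gsimp.
apply: equiv_conj; rewrite -[X in equiv _ _ X]gmul1r; apply: equivMl.
by rewrite /equiv ginv1 gmul1r; apply: comms_mulC.
Qed.

(* [(u ** v) ^ s], cut into the two arcs [v ** P i] and [Q j], bounds genus [k] once its two
   halves are allowed to be conjugated independently. *)
Definition split_bound s k := exists i j z, i + j + 1 = s /\ C k (v ** P i ** conj G (Q j) z).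

Lemma P_split i j : P (i + j + 1) = u ** (v ** P i ** P j).
Proof. by rewrite addn1 /= gpowD; gsimp. Qed.

(** All [m] insertions go into the arc [Q], each up to conjugation. The additional commutator
    replaces the resulting conjugator by the [z] of the split. *)
Lemma split_bound_power s k (g : nat) i n m : split_bound s k -> C g (P i ** P' n) ->
  C (k + 1 + m * g) (P (s + m * (i + n))).
Proof.
case=> a [c [z [<- h]]] hg.
have : conj_equiv (m * g) (Q (c + m * (i + n))) (Q c).
  elim: m => [|m IH]; first by exists e; rewrite addn0; gsimp; apply: equiv_refl.
  have -> : c + m.+1 * (i + n) = i + (c + m * (i + n)) + n by lia.
  by rewrite mulSn; apply: conj_equiv_trans (Q_insert _ hg) IH.
case=> z' h'.
have -> : a + c + 1 + m * (i + n) = a + (c + m * (i + n)) + 1 by lia.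
rewrite P_split; apply: comms_mulC; rewrite -gmulA -/(Q _).
rewrite addnC; apply: equiv_comms (equivMl _ h') _.
rewrite addnC; apply: equiv_comms h; apply: equivMl.
have -> : conj G (Q c) z' = conj G (conj G (Q c) z) (z^- ** z') by gsimp.
exact: equiv_conj1.
Qed.

Lemma split_bound_period (g : nat) i n : 0 < n -> C g (P i ** P' n) -> split_bound (i + n) g.
Proof.
case: n => // n _ h; exists 0, (i + n), (Q n)^-; split; first by lia.
move: h; rewrite P'_Q Q_add => h; apply: comms_mulC.
have -> : conj G (P i ** Q n) (Q n)^- ** (v ** P 0) = Q n ** P i ** v by gsimp.
by apply: comms_mulC; rewrite gmulA; apply: comms_mulC.
Qed.

Lemma split_bound1 : split_bound 1 0.
Proof. by exists 0, 0, b; split=> //=; rewrite /Q /v; gsimp. Qed.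

(** The conjugator brings the last [u] to the front and leaves [v^-] there, which cancels against
    the end of the other arc [v ** P 1]. *)
Lemma Q_odd r : equiv r (conj G (Q r.*2.+1) (u^- ** v))
   (v^- ** gpow G u r.*2.+2 ** gpow G v r.*2.+2).
Proof.
have := equiv_conj (u^- ** v) (equivMr u (equiv_odd r)).
rewrite -/(Q _); congr (equiv _ _ _).
by rewrite [gpow G v _.+2]gpowSr [gpow G u _.+2]/=; gsimp.
Qed.

Lemma split_bound_odd r : split_bound r.*2.+1 r.
Proof.
case: r => [|r]; first exact: split_bound1.
exists 1, r.*2.+1, (u^- ** v); split; first by rewrite doubleS; lia.
rewrite -[r.+1]addn1; apply: equiv_comms (equivMl _ (Q_odd r)) _.
rewrite gpow1; have -> : v ** (u ** v) ** (v^- ** gpow G u r.*2.+2 ** gpow G v r.*2.+2)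
  = v ** (gpow G u r.*2.+3 ** gpow G v r.*2.+2) by rewrite [gpow G u _.+3]/=; gsimp.
apply: comms_mulC; have := comms_uv r.*2.+3; rewrite [gpow G v _.+3]gpowSr; gsimp.
by [].
Qed.

Lemma comms_power_free n : C (n %/ 2 + 1) (P n).
Proof.
have H r : C (r + 1) (P r.*2.+1) by apply: equiv_comms (equiv_odd r) (comms_uv _).
rewrite divn2 -{2}(odd_double_half n); case: (odd n); first exact: H.
rewrite add0n; case: n./2 => [|r]; first by apply: (comms_le _ comms0).
by rewrite doubleS addn1; apply: comms_step; have := H r; rewrite addn1.
Qed.

(** * The gain from torsion *)

Section Torsion.
Variable N : nat.
Hypothesis uN : gpow G u N = e.
Let vN : gpow G v N = e.
Proof. by rewrite gpow_conj_inv uN; gsimp. Qed.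

(** The sorted word [u^(N-1) v^(N-1)] equals [u^- ** v^-] and is cancelled by [v ** u], so that only
    the cost of sorting remains. *)
Lemma even_insert c : N = c.+1.*2 -> C c (P c.*2.+1 ** P' 1).
Proof.
move=> NE; have := uN; have := vN; rewrite NE doubleS => /gpow_pred Ev /gpow_pred Eu.
apply: equiv1_comms (equivMr (P' 1) (equiv_odd c)) _.
by rewrite Eu Ev gpow1; gsimp.
Qed.

Lemma odd_split c : N = c.+1.*2.+1 -> C c (v ** P 1 ** conj G (Q c.*2.+1) (u^- ** v)).
Proof.
move=> NE; have := uN; have := vN; rewrite NE doubleS => /gpow_pred Ev /gpow_pred Eu.
apply: equiv1_comms (equivMl _ (Q_odd c)) _.
by rewrite Ev Eu gpow1; gsimp.
Qed.

(** With the arcs [X], [Y] of [odd_split], the two powers are [Y X] and [X Y]. As [X] is congruent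
    to a conjugate of [Y^-], what remains is the square of [Y] times a conjugate of its inverse, a
    single commutator. *)
Lemma odd_insert c : N = c.+1.*2.+1 -> C c.*2.+1 (P N ** P' N).
Proof.
move=> NE; have h := odd_split NE.
set X := v ** P 1 in h; set Y := Q c.*2.+1 in h; set z := u^- ** v in h.
have E1 : P N = Y ** X.
  by rewrite NE doubleS -addn2 gpowD /Y /X /Q /=; gsimp.
have E2 : P' N = X ** Y.
  by rewrite NE doubleS P'_Q /Y /X -[c.*2.+2]add1n Q_add gmulA.
have hX : equiv c X (conj G Y^- z).
  by move: h; rewrite /equiv; gsimp.
set W := conj G Y^- z in hX.
rewrite E1 E2.
have H : equiv (c + c) (Y ** X ** (X ** Y)) (Y ** W ** (W ** Y)).
  exact: equivM (equivMl Y hX) (equivMr Y hX).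
rewrite -addnn -addn1; apply: equiv_comms H _.
apply: comms_mulC.
have -> : W ** Y ** (Y ** W) = W ** (Y ** Y ** W) by rewrite !gmulA.
apply: comms_mulC.
have -> : Y ** Y ** W ** W = (Y^- ** Y^-)^- ** conj G (Y^- ** Y^-) z by rewrite /W; gsimp.
by apply: comms_mulC; apply: equiv_conj1.
Qed.

(** The [r.+1.*2] factors beyond [N] are inserted into the long arc of [odd_split]. *)
Lemma odd_split2 c r : N = c.+1.*2.+1 -> split_bound (N + r.+1.*2) (c + r.+1).
Proof.
move=> NE; have h := odd_split NE.
have : C r.+1 (P r.*2.+1 ** P' 1).
  rewrite -[r.+1]addn1; apply: equiv_comms (equivMr (P' 1) (equiv_odd r)) _; rewrite gpow1.
  have := comms_uv r.*2.+2; rewrite [gpow G v _.+2]gpowSr [gpow G u _.+2]/= => h2.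
  have -> : gpow G u r.*2.+1 ** gpow G v r.*2.+1 ** (v ** u) =
    (gpow G u r.*2.+1 ** gpow G v r.*2.+1 ** v) ** u by gsimp.
  by apply: comms_mulC; move: h2; rewrite !gmulA.
case/(@Q_insert _ _ c.*2.+1) => z hz.
exists 1, (r.*2.+1 + c.*2.+1 + 1), (z^- ** (u^- ** v)); split; first by rewrite NE !doubleS; lia.
rewrite addnC; apply: equiv_comms h; apply: equivMl.
have := equiv_conj (z^- ** (u^- ** v)) hz; congr (equiv _ _ _).
by gsimp.
Qed.

(** Raising [n] by [p] raises the claimed value by exactly [g], the cost of one insertion. This
    leaves odd exponents below [p] and [p] itself. An even [n] not divisible by [p] is not divisible
    by [N] either, so one further factor is paid for by the growth of [n %/ 2]. *)
Lemma comms_power_torsion n : 1 < N -> 0 < n -> C (n %/ 2 - n %/ N + 1) (P n).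
Proof.
move=> N1 n0.
have ar1 (a c d f : nat) : c <= a -> a - c + 1 + d <= a + (d + f) - (c + f) + 1 by lia.
have ar2 (a c d f : nat) : a + 1 + d <= a + c + (d + f) - (c + f) + 1 by lia.
(* [p]: the least common multiple of 2 and [N] *)
suff [p [g [i [j [p0 [pN lcm] pE Cg Hodd]]]]] : exists p (g : nat) i j,
    [/\ 0 < p, N %| p /\ (forall n, ~~ odd n -> N %| n -> p %| n), i + j = p /\ 0 < j /\ (p = 2 * (g + p %/ N)), C g (P i ** P' j) &
        forall s, s < p -> odd s -> split_bound s (s %/ 2 - s %/ N)].
  case: pE => ijp [j0 pg].
  have pN0 : p %/ N * N = p by apply: divnK.
  have dE a m : (a + m * p) %/ N = a %/ N + m * (p %/ N).
    have -> : m * p = m * (p %/ N) * N by rewrite -mulnA pN0.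
    by rewrite addnC divnMDl; [apply: addnC|lia].
  have d2 a m : (a + m * p) %/ 2 = a %/ 2 + m * (g + p %/ N).
    have -> : m * p = m * (g + p %/ N) * 2 by rewrite -mulnA [_ * 2]mulnC -pg.
    by rewrite addnC divnMDl //; apply: addnC.
  have le a : a %/ N <= a %/ 2 by apply: leq_div2l.
  have Hs s k m : split_bound s k -> C (k + 1 + m * g) (P (s + m * p)).
    by move=> sb; rewrite -ijp; apply: split_bound_power.
  have Hodd' n' : odd n' -> C (n' %/ 2 - n' %/ N + 1) (P n').
    move=> on; pose s := n' %% p; pose m := n' %/ p.
    have nE : n' = s + m * p by rewrite addnC -divn_eq.
    have os : odd s by move: on; rewrite nE oddD oddM pg oddM andbF addbF.
    have := Hs s _ m (Hodd s (ltn_pmod _ p0) os); rewrite -nE; apply: comms_le.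
    by rewrite nE dE d2 mulnDr; apply: ar1.
  have [on|en] := boolP (odd n); first exact: Hodd'.
  have [pn|npn] := boolP (p %| n).
    have [m nE] : exists m, n = p + m * p.
      by exists (n %/ p).-1; rewrite -mulSn prednK ?divnK // divn_gt0 // dvdn_leq.
    have := Hs _ _ m (split_bound_period j0 Cg); rewrite ijp -nE.
    apply: comms_le; rewrite nE dE d2.
    have -> : p %/ 2 = g + p %/ N by rewrite {1}pg mulKn.
    by rewrite mulnDr; apply: ar2.
  have n1 : n = n.-1.+1 by rewrite prednK.
  have on : odd n.-1 by move: en; rewrite {1}n1 /= negbK.
  have := comms_step (Hodd' _ on); rewrite -n1; apply: comms_le.
  have d1 : n.-1 %/ 2 + 1 = n %/ 2 by clear -n1 on; lia.
  have dN : n.-1 %/ N = n %/ N.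
    have nN : ~~ (N %| n).
      by apply: contra npn; apply: lcm.
    have r0 : 0 < n %% N by rewrite lt0n.
    rewrite {1}(divn_eq n N) -subn1 -addnBA // divnMDl; last exact: ltnW.
    rewrite [(_ - 1) %/ N]divn_small ?addn0 //.
    exact: leq_ltn_trans (leq_subr 1 _) (ltn_pmod n (ltnW N1)).
  by rewrite -d1 -dN; move: (le n.-1); clear; lia.
have [oN|eN] := boolP (odd N).
  have [c NE] : exists c, N = c.+1.*2.+1 by exists N./2.-1; lia.
  exists (N + N), c.*2.+1, N, N; have d2 : (N + N) %/ N = 2 by rewrite addnn -mul2n mulnK //; lia.
  split; [by lia| |by rewrite d2; lia|exact: odd_insert|].
    split=> [|a ea Na]; first by rewrite dvdn_addr.
    by rewrite addnn -mul2n Gauss_dvd ?Na ?dvdn2 ?ea // coprime2n.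
  move=> s sp os; have [sN|sN] := ltnP s N.
    rewrite [s %/ N]divn_small // subn0 divn2 -{1}(odd_double_half s) os.
    exact: split_bound_odd.
  have d1 : s %/ N = 1 by rewrite -(subnK sN) -[X in _ + X]mul1n addnC divnMDl; [rewrite divn_small|]; lia.
  rewrite d1; have [->|ne] := eqVneq s N.
    have -> : N %/ 2 - 1 = c by lia.
    exists 1, c.*2.+1, (u^- ** v); split; last exact: odd_split.
    by rewrite NE doubleS; lia.
  have [r sE] : exists r, s = N + r.+1.*2 by exists (s - N)./2.-1; lia.
  have -> : s %/ 2 - 1 = c + r.+1 by lia.
  by rewrite sE; apply: odd_split2.
have [c NE] : exists c, N = c.+1.*2 by exists N./2.-1; lia.
exists N, c, c.*2.+1, 1; split; [by lia|by split|by rewrite divnn; lia|exact: even_insert|].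
move=> s sN os; rewrite [s %/ N]divn_small // subn0 divn2 -{1}(odd_double_half s) os.
exact: split_bound_odd.
Qed.
End Torsion.
End PowersOfUV.
End Commutators.

(** * Commutator length of powers *)

Section Main.
Variables (G : Group) (J : Type) (A : J -> G -> Prop).
Hypothesis FP : is_free_product G A.
Local Notation "x ^-" := (ginv G x) (at level 3, format "x ^-").
Local Notation e := (gone G).

Lemma compress_power j1 (W : seq (J * G)) n : typ_joinable j1 W W ->
  compress j1 (flatten (nseq n W)) = flatten (nseq n (compress j1 W)).
Proof.
move=> jn; elim: n => //= n IH; rewrite compress_cat ?IH //.
move=> u p q v E; case: n {IH} => //= n.
case: W jn E => [|q' W] jn E; first by case: u E.
by move=> [<- _]; apply: jn E (erefl _).
Qed.

Lemma power_comms_lower (j0 : J) N n g k : 1 < N ->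
    (forall (x : G) i, x <> e -> 0 < i -> gpow G x i = e -> N <= i) ->
    0 < n -> hatG G A (gpow G g n) -> prod_comms G k (gpow G g n) ->
  n %/ 2 - n %/ N + 1 <= k.
Proof.
move=> N1 N_le n0 hat Ck.
case: (cyclic_reduction FP j0 g) => [[j [x Ax]]|[x [W [cW pW]]]].
  by exfalso; apply: (hat j x); rewrite conj_gpow; apply: gpowA.
have {}Ck := comms_conj x Ck; rewrite conj_gpow pW in Ck.
have [rW sW jW] := cW.
(* The distinguished factor is that of the first letter. By cyclic reducedness the last letter lies
   in another one, so types change across the junction of two copies of [W]. *)
case: W {pW} cW rW sW jW Ck => // -[j1 a] W' cW rW sW jW Ck; set W := (j1, a) :: W' in cW rW sW jW Ck.
have typ1 : typ j1 j1 by rewrite /typ; case: excluded_middle_informative.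
have [t [_ Ft Dt pt]] := comms_drawable FP j1 Ck.
have rWn := power_word_reduced n cW.
have [|t' [Ft' Dt' pt' rt']] := drawable_reduce Ft Dt.
  rewrite pt -prod_power => E.
  have r0 : reduced_word G A [::] by split; constructor.
  have /(congr1 size) := reduced_uniq FP rWn r0 E.
  by rewrite size_flatten_nseq; move: sW; case: (n) n0 => // n' _; rewrite /= mulSn; lia.
have [f [rf pf cf]] := typed_expand FP Ft' rt'.
have fE : f = flatten (nseq n W).
  by apply: (reduced_uniq FP) => //; rewrite pf pt' pt prod_power.
have lastW : exists u p, W = rcons u p /\ typ j1 p.1 = false.
  exists (belast (j1, a) W'), (last (j1, a) W'); split; first by rewrite /W lastI.
  have := jW (belast (j1, a) W') (last (j1, a) W') (j1, a) W' _ (erefl _).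
  rewrite -lastI => /(_ (erefl _)) ne; rewrite /typ.
  by case: excluded_middle_informative.
have [u [p [WE tp]]] := lastW.
have jn : typ_joinable j1 W W.
  by move=> u' p' q v; rewrite {1}WE => /rcons_inj [_ <-] [<- _]; rewrite tp typ1.
have t'E : t' = flatten (nseq n (compress j1 W)) by rewrite -cf fE compress_power.
set Wt := compress j1 W in t'E.
have t'E2 : t' = Wt ++ flatten (nseq n.-1 Wt) by rewrite t'E -{1}(prednK n0).
have [ne al] := rt'.
have st' : size Wt <= size t' by rewrite t'E2 size_cat leq_addr.
have nthE i : i < size Wt -> nth (true, e) t' i = nth (true, e) Wt i.
  by move=> iW; rewrite t'E2 nth_cat iW.
have Wtyp i : i < size Wt -> (nth (true, e) Wt i).1 = ~~ odd i.
  elim: i => [|i IH] iW.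
    by have [x0 [t0]] := compress_cons j1 (j1, a) W'; rewrite /Wt /W => -> /=; rewrite typ1.
  have iW' : i < size Wt by apply: ltnW.
  have := al (take i t') (nth (true, e) t' i) (nth (true, e) t' i.+1) (drop i.+2 t').
  rewrite -!drop_nth ?(leq_trans iW' st') ?(leq_trans iW st') // cat_take_drop.
  move=> /(_ (erefl _)); rewrite !nthE // IH //=.
  by case: (odd i); case: (nth _ _ _).1.
have [t0 [x0 WtE]] : exists t0 x0, Wt = rcons t0 (false, x0).
  by rewrite /Wt WE; have [t0 [x0 ->]] := compress_rcons j1 u p; exists t0, x0; rewrite tp.
have szW : size Wt = (size t0).+1 by rewrite WtE size_rcons.
(* Types alternate from [true] at the first letter to [false] at the last. *)
have ev : ~~ odd (size Wt).
  have := Wtyp (size t0); rewrite szW ltnS leqnn WtE nth_rcons ltnn eqxx /= => /(_ isT) <-.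
  by [].
apply: (@drawable_bound G Wt n (size Wt)./2 N k) => //.
- by rewrite szW in ev *; case: (size t0) ev.
- by rewrite -{1}(odd_double_half (size Wt)) (negbTE ev).
- move=> i iW; have := ne (take i t') (nth (true, e) t' i) (drop i.+1 t').
  rewrite -drop_nth ?(leq_trans iW st') // cat_take_drop => /(_ (erefl _)).
  by rewrite nthE.
by rewrite -t'E.
Qed.

(** Powers of a cyclically reduced word are never trivial, so a torsion element is conjugate into a
    factor. *)
Lemma torsion_in_factor (j0 : J) x m : 0 < m -> x <> e -> gpow G x m = e ->
  exists j a, [/\ A j a, a <> e & gpow G a m = e].
Proof.
move=> m0 xe xm; case: (cyclic_reduction FP j0 x) => [[j [y Ay]]|[y [W [cW pW]]]].
  exists j, (conj G x y); split=> // [E|].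
    by apply: xe; rewrite (conjK y x) E gmul1r gmulVr.
  by rewrite -conj_gpow xm /conj gmul1l gmulVl.
have := @gpow_cyc_length _ _ _ FP W m [::] cW; rewrite -pW -conj_gpow xm /conj gmul1l gmulVl.
by case: m m0 xm => // m _ _ /(_ (List.Forall_nil _) (erefl _)).
Qed.

Lemma commutator_power_hat j j' a b n : j <> j' -> A j a -> a <> e -> A j' b -> b <> e -> 0 < n ->
  hatG G A (gpow G (comm G a b) n).
Proof.
move=> jj Aa ae Ab be n0.
have inv1 x : x <> e -> x^- <> e by move=> xe E; apply: xe; rewrite -[x]ginvK E ginv1.
pose W := [:: (j, a^-); (j', b^-); (j, a); (j', b)].
have jj' : j' <> j by move=> E; apply: jj.
have AVa := AV FP Aa; have AVb := AV FP Ab; have ae' := inv1 _ ae; have be' := inv1 _ be.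
have cW : cyclically_reduced A W.
  split=> //; first by do 4!(apply/reduced_cons; split=> //); split; constructor.
  by move=> u p q v; rewrite -[W]/(rcons [:: (j, a^-); (j', b^-); (j, a)] (j', b)) => /rcons_inj [_ <-] [<- _].
have -> : comm G a b = word_prod G W by rewrite /= gmul1r.
by rewrite -prod_power; apply: (cyclically_reduced_hat FP); apply: cyclically_reduced_power.
Qed.

Lemma power_comms_upper j j' a b n : j <> j' -> A j a -> a <> e -> A j' b -> b <> e -> 0 < n ->
    forall K, prod_comms G K (gpow G (gmul G a^- (conj G a^-^- b)) n) ->
  exists g, hatG G A (gpow G g n) /\ prod_comms G K (gpow G g n).
Proof.
move=> jj Aa ae Ab be n0 K; rewrite ginvK => CK; exists (comm G a b).
by split=> //; apply: commutator_power_hat jj _ _ Ab _ _.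
Qed.

Lemma Nat_divE m d : 0 < d -> Nat.div m d = m %/ d.
Proof.
move=> d0; apply/esym/(PeanoNat.Nat.div_unique m d (m %/ d) (m %% d)).
  by apply/ltP; rewrite ltn_mod.
by rewrite {1}(divn_eq m d) mulnC.
Qed.

Lemma least_positive (P : nat -> Prop) i : 0 < i -> P i ->
  exists j, [/\ 0 < j, j <= i, P j & forall j', 0 < j' -> P j' -> j <= j'].
Proof.
elim/ltn_ind: i => i IH i0 Pi.
have [[j [[j0 Pj] ji]]|no] := classic (exists j, (0 < j /\ P j) /\ j < i).
  have [j' [h1 h2 h3 h4]] := IH j ji j0 Pj; exists j'; split=> //.
  exact: leq_trans h2 (ltnW ji).
exists i; split=> // j j0 Pj; rewrite leqNgt; apply/negP => ji; apply: no.
by exists j.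
Qed.

Theorem commutator_length_power (N : option nat) n :
  (forall j, exists a, A j a /\ a <> e) -> (exists j1 j2 : J, j1 <> j2) ->
  min_order_spec G N -> 0 < n ->
  is_kGn G A n (Nat.add (Nat.sub (Nat.div n 2) (floor_div_N n N)) 1).
Proof.
move=> ntriv [j1 [j2 j12]] spec n0.
have other (j : J) : exists j', j <> j'.
  have [E|] := classic (j = j1); last by exists j1.
  by exists j2; rewrite E.
case: N spec => [m|]; rewrite /min_order_spec /floor_div_N.
  case=> [[x [xe [/ltP m0 [xm _]]]] m_min].
  have m1 : 1 < m.
    case: m m0 xm {m_min} => // -[|//] _; rewrite /= gmul1r => E; by case: xe.
  have N_le y i : y <> e -> 0 < i -> gpow G y i = e -> m <= i.
    move=> ye i0 yi; have [i' [h1 h2 h3 h4]] := least_positive (P := fun i => gpow G y i = e) i0 yi.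
    apply: leq_trans h2; apply/leP; apply: (m_min y) => //; split; first exact/ltP.
    by split=> // i'' /ltP h5 h6; apply/leP; apply: h4.
  rewrite !Nat_divE //.
  split; last by move=> g k hat Ck; apply/leP; apply: (power_comms_lower j1 m1 N_le n0 hat Ck).
  have [j [a [Aa ae am]]] := torsion_in_factor j1 m0 xe xm.
  have [j' jj'] := other j; have [b [Ab be]] := ntriv j'.
  apply: (power_comms_upper jj' Aa ae Ab be n0); apply: comms_power_torsion => //.
  have := gpow_conj_inv a e m; rewrite /conj !gmul1r ginv1 !gmul1l => ->.
  by rewrite am ginv1.
(* Without torsion, [n.+1] can stand in for [N]: the order bound holds vacuously, and the quotient
   [n %/ n.+1] is 0 as required. *)
move=> notor; have N_le y i : y <> e -> 0 < i -> gpow G y i = e -> n.+1 <= i.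
  move=> ye i0 yi; have [i' [h1 h2 h3 h4]] := least_positive (P := fun i => gpow G y i = e) i0 yi.
  case: (notor y i' ye); split; first exact/ltP.
  by split=> // i'' /ltP h5 h6; apply/leP; apply: h4.
rewrite Nat_divE //; split.
  have [a [Aa ae]] := ntriv j1; have [b [Ab be]] := ntriv j2.
  apply: (power_comms_upper j12 Aa ae Ab be n0).
  by rewrite PeanoNat.Nat.sub_0_r; apply: comms_power_free.
move=> g k hat Ck; apply/leP.
by have := power_comms_lower j1 _ N_le n0 hat Ck; rewrite [n %/ n.+1]divn_small //; apply.
Qed.
End Main.

End CommutatorLength.

Theorem theorem1 (G : Group) (J : Type) (A : J -> G -> Prop)
  (N : option nat) (n : nat) :
  is_free_product G A ->
  (forall j, exists a, A j a /\ a <> gone G) ->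
  (exists j1 j2 : J, j1 <> j2) ->
  min_order_spec G N ->
  0 < n ->
  is_kGn G A n (n / 2 - floor_div_N n N + 1).
Proof.
  intros FP nontriv two spec n0.
  apply CommutatorLength.commutator_length_power; trivial.
  now destruct n; [inversion n0|].
Qed.
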